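(* Let $n,m\geq 1$ be integers with $\gcd(n,m)=1$. (i) If $n+m$ is odd, then $$\sqrt{nm}\int_{-\infty}^{\infty}\left|L\left(\tfrac12+it,\chi_4\right)\right|^2\left(\frac{m}{n}\right)^{it}\frac{dt}{\cosh(\pi t)}=\frac{\pi}{4}\,m\sum_{k=0}^{n-1}\frac{(-1)^k}{\cos\left(\frac{1+2k}{2n}m\pi\right)}+\frac{\pi}{4}\,n\sum_{\ell=0}^{m-1}\frac{(-1)^\ell}{\cos\left(\frac{1+2\ell}{2m}n\pi\right)}.$$ (ii) If $n+m$ is even, i.e. $n$ and $m$ are both odd, then $$2\sqrt{nm}\int_{-\infty}^{\infty}\left|L\left(\tfrac12+it,\chi_4\right)\right|^2\left(\frac{m}{n}\right)^{it}\frac{dt}{\cosh(\pi t)}=-\pi\frac{m}{n}\sum_{\substack{0\leq k\leq n-1\\ k\neq\frac{n-1}{2}}}\frac{(-1)^k\,k}{\cos\left(\frac{1+2k}{2n}m\pi\right)}-\pi\frac{n}{m}\sum_{\substack{0\leq \ell\leq m-1\\ \ell\neq\frac{m-1}{2}}}\frac{(-1)^\ell\,\ell}{\cos\left(\frac{1+2\ell}{2m}n\pi\right)}-(-1)^{\frac{n+m}{2}}.$$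
   Context: $\chi_4$ is the primitive odd Dirichlet character of conductor $4$: the $4$-periodic function on $\mathbb{Z}$ with $\chi_4(0)=\chi_4(2)=0$, $\chi_4(1)=1$, $\chi_4(3)=-1$. $L(s,\chi_4)$ is its Dirichlet $L$-function, $L(s,\chi_4)=\sum_{j\geq1}\chi_4(j)j^{-s}=1-3^{-s}+5^{-s}-7^{-s}+\cdots$ for $\Re(s)>1$, continued analytically to $\mathbb{C}$. For $\alpha>0$, $\alpha^{it}=e^{it\log\alpha}$. Empty sums are equal to $0$. *)

(* Defs.v *)
From Stdlib Require Import Reals ZArith.
From Coquelicot Require Import Coquelicot.

Open Scope R_scope.

Definition chi4 (j : Z) : Z :=
  match Z.modulo j 4 with
  | 1%Z => 1%Z
  | 3%Z => (-1)%Z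
  | _ => 0%Z
  end.

Definition Cexp (z : C) : C :=
  (exp (Re z) * cos (Im z), exp (Re z) * sin (Im z)).

(* a^s with the real logarithm of a; only meaningful for 0 < a, since Stdlib's
   [ln] is 0 elsewhere. *)
Definition Cpow_pos (a : R) (s : C) : C := Cexp (Cmult s (RtoC (ln a))).

Definition analytic_on_C (f : C -> C) : Prop :=
  forall s0 : C, exists (a : nat -> C) (r : R), 0 < r /\
    forall s : C, Cmod (Cminus s s0) < r ->
      is_pseries (K := C_AbsRing) (V := C_NormedModule)
        a (Cminus s s0) (f s).

(* The Dirichlet series is indexed from j = 0 by [is_series], hence the
   shift.  By the identity theorem at most one function satisfies this
   predicate. *)
Definition is_L_chi4 (L : C -> C) : Prop :=
  analytic_on_C L /\
  forall s : C, 1 < Re s ->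
    is_series (K := C_AbsRing) (V := C_NormedModule)
      (fun j : nat =>
         Cmult (RtoC (IZR (chi4 (Z.of_nat (S j)))))
               (Cpow_pos (INR (S j)) (Copp s)))
      (L s).

(* |L(1/2 + it)|^2 * alpha^(it) / cosh(pi t) *)
Definition integrand (L : C -> C) (alpha t : R) : C :=
  Cmult (RtoC (Cmod (L (1 / 2, t)) ^ 2))
        (Cdiv (Cpow_pos alpha (0, t)) (RtoC (cosh (PI * t)))).

Definition is_integral_over_R (f : R -> C) (I : C) : Prop :=
  is_RInt_gen (V := C_R_NormedModule) f
    (Rbar_locally m_infty) (Rbar_locally p_infty) I.

(* cos((1 + 2k) m pi / (2n)) *)
Definition cos_term (n m k : nat) : R :=
  cos ((1 + 2 * INR k) / (2 * INR n) * INR m * PI).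

(* [sum_f_R0 f (n - 1)] has the n terms k = 0, ..., n - 1 when n >= 1. *)
Definition sum_odd (n m : nat) : R :=
  sum_f_R0 (fun k : nat => (-1) ^ k / cos_term n m k) (n - 1).

(* Used for odd n only, where [Nat.div] by 2 is exact. *)
Definition sum_even (n m : nat) : R :=
  sum_f_R0
    (fun k : nat =>
       if Nat.eqb k (Nat.div (n - 1) 2) then 0
       else (-1) ^ k * INR k / cos_term n m k)
    (n - 1).

(* Main.v *)
Require Import Defs.
From Stdlib Require Import Reals ZArith Lra Lia Psatz.
From Coquelicot Require Import Coquelicot.
Open Scope R_scope.

(** Since the Fourier transform of 1 / cosh (pi t) is 1 / cosh (u / 2), integrating
    |S(t)|^2 (m/n)^(it) / cosh (pi t) for a partial sum S of the Dirichlet series at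
    1/2 + it gives, up to a factor, the double sum of chi4(j) chi4(k) / (n j + m k).
    This is the integral over x > 0 of the product of the truncations of
    sum_j chi4(j) exp(-j x) = 1 / (2 cosh x) at n x and m x.  Pairing consecutive odd
    numbers bounds S by O(1 + |t|) and its distance to L by O((1 + |t|) N^(-1/2)), so
    in the limit the mean value is a multiple of the integral of
    1 / (cosh (n x) cosh (m x)).  The paired series also continues L to Re s > 0, by
    the identity theorem on horizontal lines.  Finally 1 / cosh (n x) = 1 / T_n (cosh x)
    is expanded in partial fractions at the roots cos a_k of the Chebyshev polynomial
    T_n, and the integral of 1 / (cosh x - cos a) over x > 0 is (pi - a) / sin a.  When
    n and m are both odd, T_n and T_m share the root 0, whose double pole contributes
    the term (-1)^((n+m)/2). *)

(** * Finite sums *)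

(** Every exchange of a limit with an integral rests on one device: the difference between a
    function and a finite sum is dominated on the half-line by c exp (- a x), so the two integrals
    over [0, b] differ by at most c / a, uniformly in b. This is why the truncation errors below
    keep their exponential factor even where a pointwise bound would look simpler. The Fourier
    transform of the secant is found without residues. Integrating its exponential series termwise
    leads to the alternating sum of b / (u^2 + b^2) over b = (2 k + 1) pi. Multiplied by cosh (u /
    2), a partial sum is the integral of cosh (u y) against a cosine kernel over [0, 1/2]; replacing
    u by 0 costs a term of Riemann-Lebesgue type, and u = 0 is the Leibniz series for pi / 4. For
    the continuation, t is frozen: the real and imaginary parts of L are then real analytic
    functions of s, and a real identity theorem on s > 0 is enough. *)

Fixpoint rsum (f : nat -> R) (n : nat) : R :=
  match n with
  | O => 0
  | S p => rsum f p + f p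
  end.

Lemma rsum_ext f g n :
  (forall k, (k < n)%nat -> f k = g k) -> rsum f n = rsum g n.
Proof.
  induction n as [|n IH]; intros H; simpl; [reflexivity|].
  rewrite IH, H by auto with arith; reflexivity.
Qed.

Lemma rsum_plus f g n : rsum (fun k => f k + g k) n = rsum f n + rsum g n.
Proof. induction n as [|n IH]; simpl; [|rewrite IH]; ring. Qed.

Lemma rsum_minus f g n : rsum (fun k => f k - g k) n = rsum f n - rsum g n.
Proof. induction n as [|n IH]; simpl; [|rewrite IH]; ring. Qed.

Lemma rsum_scal c f n : rsum (fun k => c * f k) n = c * rsum f n.
Proof. induction n as [|n IH]; simpl; [|rewrite IH]; ring. Qed.

Lemma rsum_const c n : rsum (fun _ => c) n = INR n * c.
Proof. induction n as [|n IH]; [simpl; ring|]. simpl rsum. rewrite IH, S_INR. ring. Qed.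

Lemma rsum_zero f n : (forall k, (k < n)%nat -> f k = 0) -> rsum f n = 0.
Proof. intros H. rewrite (rsum_ext _ (fun _ => 0)), rsum_const by exact H. ring. Qed.

Lemma rsum_swap f n m :
  rsum (fun i => rsum (fun j => f i j) m) n = rsum (fun j => rsum (fun i => f i j) n) m.
Proof.
  induction n as [|n IH]; simpl.
  - symmetry. now apply rsum_zero.
  - now rewrite IH, <- rsum_plus.
Qed.

Lemma rsum_mult f g n m :
  rsum f n * rsum g m = rsum (fun i => rsum (fun j => f i * g j) m) n.
Proof.
  rewrite Rmult_comm, <- rsum_scal. apply rsum_ext. intros i _.
  now rewrite rsum_scal, Rmult_comm.
Qed.

Lemma rsum_recl f n : rsum f (S n) = f 0%nat + rsum (fun k => f (S k)) n.
Proof.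
  induction n as [|n IH]; [simpl; ring|].
  change (rsum f (S n) + f (S n) = f 0%nat + (rsum (fun k => f (S k)) n + f (S n))).
  rewrite IH. ring.
Qed.

Lemma rsum_rev f n : rsum f n = rsum (fun k => f (n - 1 - k)%nat) n.
Proof.
  induction n as [|n IH]; [reflexivity|].
  rewrite (rsum_recl (fun k => f (S n - 1 - k)%nat)). simpl rsum at 1. rewrite IH.
  replace (S n - 1 - 0)%nat with n by lia. rewrite Rplus_comm. f_equal.
  apply rsum_ext. intros k Hk. f_equal. lia.
Qed.

Lemma rsum_le f g n :
  (forall k, (k < n)%nat -> f k <= g k) -> rsum f n <= rsum g n.
Proof.
  induction n as [|n IH]; intros H; simpl; [lra|].
  assert (f n <= g n) by auto with arith.
  assert (rsum f n <= rsum g n) by auto with arith. lra.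
Qed.

Lemma rsum_Rabs_le f g n :
  (forall k, (k < n)%nat -> Rabs (f k) <= g k) -> Rabs (rsum f n) <= rsum g n.
Proof.
  induction n as [|n IH]; intros H; simpl; [rewrite Rabs_R0; lra|].
  eapply Rle_trans; [apply Rabs_triang|].
  apply Rplus_le_compat; auto with arith.
Qed.

Lemma rsum_telescope f n : rsum (fun k => f k - f (S k)) n = f 0%nat - f n.
Proof. induction n as [|n IH]; simpl; [|rewrite IH]; ring. Qed.

Lemma rsum_single f n i :
  (i < n)%nat -> (forall k, (k < n)%nat -> k <> i -> f k = 0) -> rsum f n = f i.
Proof.
  induction n as [|n IH]; intros Hi H; [lia|]. simpl.
  destruct (Nat.eq_dec i n) as [->|Hne].
  - rewrite rsum_zero; [ring|]. intros k Hk. apply H; lia.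
  - rewrite IH, (H n) by (try lia; intros; apply H; lia). ring.
Qed.

Lemma rsum_even f n :
  rsum f (2 * n) = rsum (fun b => f (2 * b)%nat + f (2 * b + 1)%nat) n.
Proof.
  induction n as [|n IH]; [reflexivity|].
  replace (2 * S n)%nat with (S (S (2 * n))) by lia.
  cbn [rsum]. rewrite IH.
  replace (2 * n + 1)%nat with (S (2 * n)) by lia. ring.
Qed.

Lemma rsum_sum_f_R0 f n : (1 <= n)%nat -> sum_f_R0 f (n - 1) = rsum f n.
Proof.
  intros Hn. destruct n as [|n]; [lia|]. clear Hn.
  replace (S n - 1)%nat with n by lia.
  induction n as [|n IH]; simpl in *; [ring|]. rewrite IH. ring.
Qed.

Lemma sum_n_rsum (f : nat -> R) n : sum_n f n = rsum f (S n).
Proof.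
  induction n as [|n IH]; [rewrite sum_O; simpl; ring|].
  rewrite sum_Sn, IH. reflexivity.
Qed.

Lemma continuous_rsum (f : nat -> R -> R) n x :
  (forall k, (k < n)%nat -> continuous (f k) x) ->
  continuous (fun y => rsum (fun k => f k y) n) x.
Proof.
  induction n as [|n IH]; intros H; simpl; [apply continuous_const|].
  apply (continuous_plus (fun y => rsum (fun k => f k y) n)); auto with arith.
Qed.

(** * Integrals over the half-line *)

Lemma continuous_ex_RInt (f : R -> R) a b :
  (forall x, continuous f x) -> ex_RInt f a b.
Proof. intros H. apply @ex_RInt_continuous. auto. Qed.

(** Continuity is bundled with the limit because [RInt] is total: it guarantees that each [RInt] met
    here is a genuine integral. *)
Definition half_int (f : R -> R) (J : R) : Prop :=
  (forall x, continuous f x) /\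
  forall eps, 0 < eps ->
    exists X, 0 <= X /\ forall b, X <= b -> Rabs (RInt f 0 b - J) < eps.

Lemma half_int_ext f g J :
  (forall x, f x = g x) -> half_int f J -> half_int g J.
Proof.
  intros H [Hc Hl]. split.
  - intros x. apply (continuous_ext f); auto.
  - intros eps He. destruct (Hl eps He) as [X [HX HJ]]. exists X. split; [exact HX|].
    intros b Hb. rewrite <- (RInt_ext f) by (intros; apply H). auto.
Qed.

Lemma half_int_plus f g J K :
  half_int f J -> half_int g K -> half_int (fun x => f x + g x) (J + K).
Proof.
  intros [Hf Lf] [Hg Lg]. split.
  - intros x. apply (continuous_plus f g); auto.
  - intros eps He.
    destruct (Lf (eps / 2)) as [X [HX BX]]; [lra|].
    destruct (Lg (eps / 2)) as [Y [HY BY]]; [lra|].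
    exists (Rmax X Y). split; [eapply Rle_trans; [exact HX|apply Rmax_l]|].
    intros b Hb.
    specialize (BX b (Rle_trans _ _ _ (Rmax_l _ _) Hb)).
    specialize (BY b (Rle_trans _ _ _ (Rmax_r _ _) Hb)).
    rewrite (RInt_plus f g) by (apply continuous_ex_RInt; auto).
    unfold plus; simpl.
    replace (RInt f 0 b + RInt g 0 b - (J + K))
      with ((RInt f 0 b - J) + (RInt g 0 b - K)) by ring.
    eapply Rle_lt_trans; [apply Rabs_triang|]. lra.
Qed.

Lemma half_int_0 : half_int (fun _ => 0) 0.
Proof.
  split; [intros x; apply continuous_const|].
  intros eps He. exists 0. split; [lra|]. intros b _.
  rewrite RInt_const. unfold scal; simpl; unfold mult; simpl.
  now rewrite Rmult_0_r, Rminus_0_r, Rabs_R0.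
Qed.

Lemma half_int_scal c f J : half_int f J -> half_int (fun x => c * f x) (c * J).
Proof.
  intros [Hf Lf]. split.
  - intros x. apply (continuous_scal_r (K := R_AbsRing) c f); auto.
  - intros eps He. assert (Hc := Rabs_pos c).
    destruct (Lf (eps / (Rabs c + 1))) as [X [HX BX]].
    { apply Rdiv_lt_0_compat; lra. }
    exists X. split; [exact HX|]. intros b Hb. specialize (BX b Hb).
    rewrite (RInt_scal f) by (apply continuous_ex_RInt; auto).
    unfold scal; simpl; unfold mult; simpl.
    rewrite <- Rmult_minus_distr_l, Rabs_mult.
    apply Rmult_lt_compat_r with (r := Rabs c + 1) in BX; [|lra].
    replace (eps / (Rabs c + 1) * (Rabs c + 1)) with eps in BX by (field; lra).
    assert (Hp := Rabs_pos (RInt f 0 b - J)). nra.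
Qed.

Lemma half_int_rsum (f : nat -> R -> R) J n :
  (forall k, (k < n)%nat -> half_int (f k) (J k)) ->
  half_int (fun x => rsum (fun k => f k x) n) (rsum J n).
Proof.
  induction n as [|n IH]; intros H; simpl; [apply half_int_0|].
  apply (half_int_plus (fun x => rsum (fun k => f k x) n)); auto with arith.
Qed.

Lemma half_int_derive (f F : R -> R) (l : R) :
  (forall x, is_derive F x (f x)) -> (forall x, continuous f x) ->
  is_lim F p_infty l -> half_int f (l - F 0).
Proof.
  intros Hd Hc Hl. split; [exact Hc|]. intros eps He.
  apply is_lim_spec in Hl. destruct (Hl (mkposreal eps He)) as [M HM]. simpl in HM.
  exists (Rmax 0 (M + 1)). split; [apply Rmax_l|]. intros b Hb.
  assert (M < b) by (generalize (Rmax_r 0 (M + 1)); lra).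
  rewrite (is_RInt_unique f 0 b (minus (F b) (F 0))).
  - unfold minus, plus, opp; simpl.
    replace (F b + - F 0 - (l - F 0)) with (F b - l) by ring. auto.
  - apply (@is_RInt_derive R_CompleteNormedModule F f); auto.
Qed.

Lemma RInt_diff_bound (f g w : R -> R) b :
  0 <= b -> (forall x, continuous f x) -> (forall x, continuous g x) ->
  (forall x, continuous w x) ->
  (forall x, 0 <= x -> Rabs (f x - g x) <= w x) ->
  Rabs (RInt f 0 b - RInt g 0 b) <= RInt w 0 b.
Proof.
  intros Hb Hf Hg Hw H.
  replace (RInt f 0 b - RInt g 0 b) with (RInt (fun x => minus (f x) (g x)) 0 b)
    by (apply (RInt_minus f g 0 b); apply continuous_ex_RInt; auto).
  assert (Hd : forall x, continuous (fun x => minus (f x) (g x)) x)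
    by (intros x; apply (continuous_minus f g); auto).
  eapply Rle_trans; [apply abs_RInt_le; [exact Hb|apply continuous_ex_RInt, Hd]|].
  apply RInt_le; try exact Hb.
  - apply continuous_ex_RInt. intros x.
    apply (continuous_comp (fun x => minus (f x) (g x)) Rabs); [apply Hd|].
    apply continuous_Rabs.
  - apply continuous_ex_RInt; auto.
  - intros x [Hx _]. apply H. lra.
Qed.

Lemma RInt_exp_bound c a b :
  0 < a -> 0 <= c -> 0 <= b -> RInt (fun x => c * exp (- (a * x))) 0 b <= c / a.
Proof.
  intros Ha Hc Hb.
  rewrite (is_RInt_unique _ 0 b
    (minus (- (c / a) * exp (- (a * b))) (- (c / a) * exp (- (a * 0))))).
  - unfold minus, plus, opp; simpl.
    rewrite Rmult_0_r, Ropp_0, exp_0.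
    assert (0 <= c / a) by (apply Rdiv_le_0_compat; lra).
    assert (0 < exp (- (a * b))) by apply exp_pos. nra.
  - apply (@is_RInt_derive R_CompleteNormedModule (fun x => - (c / a) * exp (- (a * x)))).
    + intros x _. auto_derive; [trivial|]. field. lra.
    + intros x _. apply @ex_derive_continuous. now auto_derive.
Qed.

(** The bound does not involve b. It is made small either by a large rate a (truncated geometric
    series) or by a small factor c (partial sums of L). *)
Lemma RInt_diff_exp_bound (f g : R -> R) c a b :
  0 < a -> 0 <= c -> 0 <= b ->
  (forall x, continuous f x) -> (forall x, continuous g x) ->
  (forall x, 0 <= x -> Rabs (f x - g x) <= c * exp (- (a * x))) ->
  Rabs (RInt f 0 b - RInt g 0 b) <= c / a.
Proof.
  intros Ha Hc Hb Hf Hg H.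
  eapply Rle_trans; [apply (RInt_diff_bound f g (fun x => c * exp (- (a * x)))); auto|].
  - intros x. apply @ex_derive_continuous. now auto_derive.
  - now apply RInt_exp_bound.
Qed.

(** Since [eN] is independent of b, the limits in b and in N may be exchanged. *)
Lemma half_int_limit (h : R -> R) (hN : nat -> R -> R) (JN eN : nat -> R) (J : R) :
  (forall x, continuous h x) ->
  (forall N, half_int (hN N) (JN N)) ->
  (forall N b, 0 <= b -> Rabs (RInt h 0 b - RInt (hN N) 0 b) <= eN N) ->
  is_lim_seq eN 0 -> is_lim_seq JN J -> half_int h J.
Proof.
  intros Hh HN Hb He HJ. split; [exact Hh|]. intros eps Heps.
  assert (H3 : 0 < eps / 3) by lra.
  apply is_lim_seq_spec in He. apply is_lim_seq_spec in HJ.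
  destruct (He (mkposreal _ H3)) as [N1 B1]. destruct (HJ (mkposreal _ H3)) as [N2 B2].
  simpl in B1, B2. set (N := max N1 N2).
  specialize (B1 N (Nat.le_max_l _ _)). specialize (B2 N (Nat.le_max_r _ _)).
  destruct (HN N) as [_ L]. destruct (L _ H3) as [X [HX BX]].
  exists X. split; [exact HX|]. intros b Hxb.
  specialize (BX b Hxb). specialize (Hb N b (Rle_trans _ _ _ HX Hxb)).
  rewrite Rminus_0_r in B1. apply Rabs_def2 in B1.
  apply Rabs_def2 in B2. apply Rabs_def2 in BX. apply Rabs_le_between in Hb.
  apply Rabs_def1; lra.
Qed.

(** The same uniform bound used in the other direction: the limiting integral is known, and the
    behaviour of the approximating values is deduced. *)
Lemma half_int_limit_values (h : R -> R) (hN : nat -> R -> R) (JN eN : nat -> R) (J : R) :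
  half_int h J -> (forall N, half_int (hN N) (JN N)) ->
  (forall N b, 0 <= b -> Rabs (RInt h 0 b - RInt (hN N) 0 b) <= eN N) ->
  is_lim_seq eN 0 -> is_lim_seq JN J.
Proof.
  intros Hh HN Hb He.
  assert (HJ : forall N, Rabs (JN N - J) <= eN N).
  { intros N. apply le_epsilon. intros eps Heps.
    destruct Hh as [_ L]. destruct (HN N) as [_ LN].
    destruct (L (eps / 2)) as [X [HX BX]]; [lra|].
    destruct (LN (eps / 2)) as [Y [HY BY]]; [lra|].
    specialize (BX (Rmax X Y) (Rmax_l _ _)). specialize (BY (Rmax X Y) (Rmax_r _ _)).
    specialize (Hb N (Rmax X Y) (Rle_trans _ _ _ HX (Rmax_l _ _))).
    apply Rabs_def2 in BX. apply Rabs_def2 in BY. apply Rabs_le_between in Hb.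
    apply Rabs_le. lra. }
  apply is_lim_seq_spec. apply is_lim_seq_spec in He. intros eps.
  destruct (He eps) as [N0 B]. exists N0. intros N HN0.
  specialize (B N HN0). rewrite Rminus_0_r in B.
  eapply Rle_lt_trans; [apply HJ|]. eapply Rle_lt_trans; [apply Rle_abs|exact B].
Qed.

(** * Partial fractions of 1 / T_n and the integral of 1 / (cosh (n x) cosh (m x)) *)

(** Telescoping of 2 sin theta cos ((2 k + 1) theta) = sin ((2 k + 2) theta) - sin (2 k theta). It
    serves twice: for the orthogonality of cosines over the Chebyshev nodes, and for the cosine
    kernel in the Riemann-Lebesgue estimate. *)
Lemma rsum_cos_odd theta K :
  2 * sin theta * rsum (fun k => cos ((2 * INR k + 1) * theta)) K = sin (2 * INR K * theta).
Proof.
  induction K as [|K IH].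
  - simpl. rewrite !Rmult_0_r, Rmult_0_l, sin_0. ring.
  - cbn [rsum]. rewrite Rmult_plus_distr_l, IH, S_INR.
    replace (2 * INR K * theta) with ((2 * INR K + 1) * theta - theta) by ring.
    replace (2 * (INR K + 1) * theta) with ((2 * INR K + 1) * theta + theta) by ring.
    rewrite sin_minus, sin_plus. ring.
Qed.

Lemma cosh_pos x : 0 < cosh x.
Proof. unfold cosh. generalize (exp_pos x) (exp_pos (- x)). lra. Qed.

Lemma cosh_ge_1 x : 1 <= cosh x.
Proof.
  unfold cosh. rewrite exp_Ropp. assert (H := exp_pos x).
  replace ((exp x + / exp x) / 2) with (1 + (exp x - 1) ^ 2 * (/ exp x / 2)) by (field; lra).
  assert (0 < / exp x) by now apply Rinv_0_lt_compat.
  generalize (pow2_ge_0 (exp x - 1)). nra.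
Qed.

Lemma cosh_opp x : cosh (- x) = cosh x.
Proof. unfold cosh. rewrite Ropp_involutive. field. Qed.

(* At [a] a zero of [cos (n a)], i.e. [cos a] a root of the Chebyshev polynomial
   [T_n], this divides [T_n c] by [c - cos a]. *)
Lemma chebyshev_divided_difference (T : nat -> R) c a p :
  T 0%nat = 1 -> T 1%nat = c -> (forall j, T (S (S j)) = 2 * c * T (S j) - T j) ->
  sin a * (T (S p) - cos (INR (S p) * a)) =
  (c - cos a) *
    (sin (INR (S p) * a) + 2 * rsum (fun i => T (S i) * sin ((INR p - INR i) * a)) p).
Proof.
  intros T0 T1 TS.
  set (Q := fun p => sin (INR (S p) * a)
                     + 2 * rsum (fun i => T (S i) * sin ((INR p - INR i) * a)) p).
  change (sin a * (T (S p) - cos (INR (S p) * a)) = (c - cos a) * Q p).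
  assert (HQ : forall q, Q (S (S q)) = 2 * cos a * Q (S q) - Q q + 2 * T (S (S q)) * sin a).
  { intros q. unfold Q. cbn [rsum].
    assert (E1 : rsum (fun i => T (S i) * sin ((INR (S (S q)) - INR i) * a)) q
            = 2 * cos a * rsum (fun i => T (S i) * sin ((INR (S q) - INR i) * a)) q
              - rsum (fun i => T (S i) * sin ((INR q - INR i) * a)) q).
    { rewrite <- rsum_scal, <- rsum_minus. apply rsum_ext. intros i _.
      rewrite !S_INR.
      replace ((INR q + 1 + 1 - INR i) * a) with ((INR q + 1 - INR i) * a + a) by ring.
      replace ((INR q - INR i) * a) with ((INR q + 1 - INR i) * a - a) by ring.
      rewrite sin_plus, sin_minus. ring. }
    rewrite E1, !S_INR.
    replace ((INR q + 1 + 1 - INR q) * a) with (2 * a) by ring.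
    replace ((INR q + 1 + 1 - (INR q + 1)) * a) with a by ring.
    replace ((INR q + 1 - INR q) * a) with a by ring.
    replace ((INR q + 1 + 1 + 1) * a) with ((INR q + 1 + 1) * a + a) by ring.
    replace ((INR q + 1) * a) with ((INR q + 1 + 1) * a - a) by ring.
    rewrite sin_plus, sin_minus, sin_2a. ring. }
  (* The recurrence for [Q] has order two, so two consecutive cases go through the induction
     together. *)
  enough (H : sin a * (T (S p) - cos (INR (S p) * a)) = (c - cos a) * Q p /\
              sin a * (T (S (S p)) - cos (INR (S (S p)) * a)) = (c - cos a) * Q (S p))
    by apply H.
  induction p as [|p [IH1 IH2]].
  - split.
    + unfold Q; simpl. rewrite T1, Rmult_1_l. ring.
    + unfold Q; simpl. rewrite TS, T1, T0.
      replace ((1 + 1) * a) with (2 * a) by ring.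
      replace ((1 - 0) * a) with a by ring.
      rewrite sin_2a, cos_2a_cos. ring.
  - split; [exact IH2|]. rewrite HQ, TS.
    replace (cos (INR (S (S (S p))) * a))
      with (2 * cos a * cos (INR (S (S p)) * a) - cos (INR (S p) * a)).
    + transitivity (2 * cos a * ((c - cos a) * Q (S p)) - (c - cos a) * Q p
                    + 2 * (c - cos a) * T (S (S p)) * sin a); [|ring].
      rewrite <- IH1, <- IH2. ring.
    + rewrite !S_INR.
      replace ((INR p + 1 + 1 + 1) * a) with ((INR p + 1 + 1) * a + a) by ring.
      replace ((INR p + 1) * a) with ((INR p + 1 + 1) * a - a) by ring.
      rewrite cos_plus, cos_minus. ring.
Qed.

(** * Roots of T_n and residues of 1 / T_n *)

Definition node (n k : nat) : R := (1 + 2 * INR k) / (2 * INR n) * PI.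
(** Residue of 1 / T_n at cos a, a = [node n k]: as T_n (cos a) = cos (n a), the derivative of T_n
    there is n sin (n a) / sin a, with sin (n a) = (-1)^k. *)
Definition weight (n k : nat) : R := (-1) ^ k * sin (node n k) / INR n.

Lemma INR_pos n : (1 <= n)%nat -> 0 < INR n.
Proof. intros H. apply lt_0_INR. lia. Qed.

Lemma node_bounds n k : (k < n)%nat -> 0 < node n k < PI.
Proof.
  intros Hk. unfold node. assert (Hn : 0 < INR n) by (apply INR_pos; lia).
  assert (Hk0 := pos_INR k). assert (Hp := PI_RGT_0).
  assert (INR k + 1 <= INR n) by (rewrite <- S_INR; apply le_INR; lia).
  assert (0 < (1 + 2 * INR k) / (2 * INR n)) by (apply Rdiv_lt_0_compat; lra).
  assert ((1 + 2 * INR k) / (2 * INR n) < 1).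
  { apply Rmult_lt_reg_r with (2 * INR n); [lra|].
    replace ((1 + 2 * INR k) / (2 * INR n) * (2 * INR n)) with (1 + 2 * INR k) by (field; lra).
    lra. }
  nra.
Qed.

Lemma sin_node_pos n k : (k < n)%nat -> 0 < sin (node n k).
Proof. intros H. apply node_bounds in H. apply sin_gt_0; lra. Qed.

Lemma node_cos_lt_1 n k : (k < n)%nat -> cos (node n k) < 1.
Proof.
  intros H. apply sin_node_pos in H. generalize (sin2_cos2 (node n k)). unfold Rsqr. nra.
Qed.

Lemma node_mult n k : (1 <= n)%nat -> INR n * node n k = INR k * PI + PI / 2.
Proof. intros H. apply INR_pos in H. unfold node. field. lra. Qed.

Lemma sin_cos_kpi k : sin (INR k * PI) = 0 /\ cos (INR k * PI) = (-1) ^ k.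
Proof.
  induction k as [|k [IH1 IH2]].
  - simpl. now rewrite Rmult_0_l, sin_0, cos_0.
  - rewrite S_INR. replace ((INR k + 1) * PI) with (INR k * PI + PI) by ring.
    rewrite neg_sin, neg_cos, IH1, IH2. simpl. split; ring.
Qed.

Lemma cos_node_mult n k : (1 <= n)%nat -> cos (INR n * node n k) = 0.
Proof.
  intros H. rewrite node_mult, cos_plus, cos_PI2, sin_PI2 by exact H.
  rewrite (proj1 (sin_cos_kpi k)). ring.
Qed.

Lemma sin_node_mult n k : (1 <= n)%nat -> sin (INR n * node n k) = (-1) ^ k.
Proof.
  intros H. rewrite node_mult, sin_plus, cos_PI2, sin_PI2 by exact H.
  rewrite (proj2 (sin_cos_kpi k)). ring.
Qed.

Lemma pow_m1_sqr k : (-1) ^ k * (-1) ^ k = 1.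
Proof.
  rewrite <- Rpow_mult_distr. replace (-1 * -1) with 1 by ring. apply pow1.
Qed.

(** By the divided difference, T_n times the k-th fraction is (1 + 2 sum of T_i cos (i a_k) over 0 <
    i < n) / n; summed over the nodes, every cosine cancels and 1 remains. Only the recurrence of T
    is assumed, so that T_j = cosh (j x) yields the integrand and T_j = cos (j x) the cofactors at
    the other roots. *)
Lemma chebyshev_inv_partial_fractions (T : nat -> R) c n :
  (1 <= n)%nat ->
  T 0%nat = 1 -> T 1%nat = c -> (forall j, T (S (S j)) = 2 * c * T (S j) - T j) ->
  T n <> 0 ->
  rsum (fun k => weight n k * / (c - cos (node n k))) n = / T n.
Proof.
  intros Hn T0 T1 TS HT. assert (HnR := INR_pos n Hn).
  destruct n as [|p]; [lia|].
  assert (Hsum : rsum (fun k => T (S p) * (weight (S p) k * / (c - cos (node (S p) k)))) (S p) = 1).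
  { rewrite (rsum_ext _ (fun k => / INR (S p) *
      (1 + 2 * rsum (fun i => T (S i) * cos (INR (S i) * node (S p) k)) p))).
    - rewrite rsum_scal, rsum_plus, rsum_scal, rsum_const, rsum_swap.
      rewrite (rsum_zero _ p); [field; lra|].
      intros i Hi. rewrite rsum_scal.
      assert (HiR : INR (S i) < INR (S p)) by (apply lt_INR; lia).
      assert (Hi0 : 0 < INR (S i)) by (apply INR_pos; lia).
      (* At the nodes (i + 1) a_k = (2 k + 1) theta, so the cosine sum times 2 sin theta is sin ((i
         + 1) pi) = 0; the condition i + 1 < n keeps sin theta positive. *)
      set (theta := INR (S i) * PI / (2 * INR (S p))).
      assert (Hth : 0 < sin theta).
      { apply sin_gt_0; unfold theta.
        - apply Rdiv_lt_0_compat; [|lra]. apply Rmult_lt_0_compat; [lra|apply PI_RGT_0].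
        - apply Rmult_lt_reg_r with (2 * INR (S p)); [lra|].
          replace (INR (S i) * PI / (2 * INR (S p)) * (2 * INR (S p))) with (INR (S i) * PI)
            by (field; lra).
          generalize PI_RGT_0. nra. }
      rewrite (rsum_ext _ (fun k => cos ((2 * INR k + 1) * theta))).
      + assert (E := rsum_cos_odd theta (S p)).
        replace (2 * INR (S p) * theta) with (INR (S i) * PI) in E by (unfold theta; field; lra).
        rewrite (proj1 (sin_cos_kpi _)) in E.
        apply Rmult_integral in E. destruct E as [E|E]; [lra|]. rewrite E. ring.
      + intros k _. f_equal. unfold theta, node. field. lra.
    - intros k Hk.
      assert (Hs := sin_node_pos _ _ Hk).
      assert (E := chebyshev_divided_difference T c (node (S p) k) p T0 T1 TS).
      rewrite cos_node_mult, sin_node_mult in E by exact Hn.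
      (* Otherwise the divided difference identity would give sin a T_n = 0, against [HT]. *)
      assert (Hc : c - cos (node (S p) k) <> 0).
      { intros Hc. rewrite Hc, Rmult_0_l, Rminus_0_r in E.
        apply Rmult_integral in E. destruct E; [lra|contradiction]. }
      assert (E2 : rsum (fun i => T (S i) * sin ((INR p - INR i) * node (S p) k)) p
              = (-1) ^ k * rsum (fun i => T (S i) * cos (INR (S i) * node (S p) k)) p).
      { rewrite <- rsum_scal. apply rsum_ext. intros i _.
        replace ((INR p - INR i) * node (S p) k)
          with (INR (S p) * node (S p) k - INR (S i) * node (S p) k)
          by (rewrite !S_INR; ring).
        rewrite sin_minus, cos_node_mult, sin_node_mult by exact Hn. ring. }
      rewrite E2 in E. clear E2.
      set (Sg := rsum (fun i => T (S i) * cos (INR (S i) * node (S p) k)) p) in *.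
      unfold weight.
      transitivity ((-1) ^ k * (sin (node (S p) k) * (T (S p) - 0))
                    / (INR (S p) * (c - cos (node (S p) k)))); [field; lra|].
      rewrite E.
      transitivity ((-1) ^ k * (-1) ^ k * (1 + 2 * Sg) / INR (S p)); [field; lra|].
      rewrite pow_m1_sqr. field. lra. }
  rewrite rsum_scal in Hsum.
  apply Rmult_eq_reg_l with (T (S p)); [|exact HT]. rewrite Hsum. field. exact HT.
Qed.

Lemma cosh_mult_recurrence x j :
  cosh (INR (S (S j)) * x) = 2 * cosh x * cosh (INR (S j) * x) - cosh (INR j * x).
Proof.
  rewrite !S_INR.
  replace ((INR j + 1 + 1) * x) with (INR j * x + x + x) by ring.
  replace ((INR j + 1) * x) with (INR j * x + x) by ring.
  unfold cosh. rewrite !exp_Ropp, !exp_plus.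
  generalize (exp_pos (INR j * x)) (exp_pos x). intros. field. lra.
Qed.

Lemma cos_mult_recurrence x j :
  cos (INR (S (S j)) * x) = 2 * cos x * cos (INR (S j) * x) - cos (INR j * x).
Proof.
  rewrite !S_INR.
  replace ((INR j + 1 + 1) * x) with ((INR j + 1) * x + x) by ring.
  replace (INR j * x) with ((INR j + 1) * x - x) by ring.
  rewrite cos_plus, cos_minus. ring.
Qed.

Lemma inv_cosh_partial_fractions n x :
  (1 <= n)%nat ->
  rsum (fun k => weight n k * / (cosh x - cos (node n k))) n = / cosh (INR n * x).
Proof.
  intros Hn. apply (chebyshev_inv_partial_fractions (fun j => cosh (INR j * x))); auto.
  - simpl. rewrite Rmult_0_l. apply cosh_0.
  - simpl. now rewrite Rmult_1_l.
  - apply cosh_mult_recurrence.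
  - generalize (cosh_pos (INR n * x)). lra.
Qed.

Lemma inv_cos_partial_fractions n x :
  (1 <= n)%nat -> cos (INR n * x) <> 0 ->
  rsum (fun k => weight n k * / (cos x - cos (node n k))) n = / cos (INR n * x).
Proof.
  intros Hn. apply (chebyshev_inv_partial_fractions (fun j => cos (INR j * x))); auto.
  - simpl. rewrite Rmult_0_l. apply cos_0.
  - simpl. now rewrite Rmult_1_l.
  - apply cos_mult_recurrence.
Qed.

(** * Half-line integrals of the elementary fractions *)

Lemma is_lim_exp_decay a : 0 < a -> is_lim (fun x => exp (- (a * x))) p_infty 0.
Proof.
  intros Ha. apply is_lim_spec. intros eps. exists (/ (a * eps)). intros x Hx.
  assert (He := cond_pos eps).
  assert (Hi : 0 < / (a * eps)) by (apply Rinv_0_lt_compat; nra).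
  rewrite Rminus_0_r, Rabs_pos_eq by (left; apply exp_pos).
  rewrite exp_Ropp.
  assert (H : 1 + a * x < exp (a * x)) by (apply exp_ineq1; nra).
  assert (H2 : / eps < a * x).
  { apply Rmult_lt_compat_l with (r := a) in Hx; [|exact Ha].
    replace (a * / (a * eps)) with (/ eps) in Hx by (field; lra). exact Hx. }
  rewrite <- (Rinv_inv eps). apply Rinv_lt_contravar.
  - apply Rmult_lt_0_compat; [now apply Rinv_0_lt_compat|apply exp_pos].
  - lra.
Qed.

Lemma half_int_inv_cosh_sub_cos a :
  0 < a < PI -> half_int (fun x => / (cosh x - cos a)) ((PI - a) / sin a).
Proof.
  intros Ha.
  assert (Hs : 0 < sin a) by (apply sin_gt_0; lra).
  assert (Hsc := sin2_cos2 a). unfold Rsqr in Hsc.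
  assert (Hc1 : cos a < 1) by nra.
  (* With y = exp (- x) the integral becomes that of 2 / ((y - cos a)^2 + (sin a)^2) over 0 < y < 1.
     The choice of exp (- x) rather than exp x sends the infinite end to y = 0, where the
     antiderivative is continuous. *)
  set (F := fun x => - (2 / sin a) * atan ((exp (- (1 * x)) - cos a) / sin a)).
  assert (HF0 : F 0 = - (a / sin a)).
  { unfold F. rewrite Rmult_0_r, Ropp_0, exp_0.
    replace ((1 - cos a) / sin a) with (tan (a / 2)).
    - rewrite atan_tan by lra. field. lra.
    - assert (0 < cos (a / 2)) by (apply cos_gt_0; lra).
      assert (0 < sin (a / 2)) by (apply sin_gt_0; lra).
      unfold tan. replace a with (2 * (a / 2)) at 3 4 by field.
      rewrite sin_2a, cos_2a_sin. field. lra. }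
  replace ((PI - a) / sin a) with ((2 / sin a) * (PI / 2 - a) - F 0) by (rewrite HF0; field; lra).
  apply half_int_derive.
  - intros x. unfold F. auto_derive; [trivial|].
    rewrite (Rmult_1_l x). unfold cosh. rewrite exp_Ropp.
    assert (He := exp_pos x). set (e := exp x) in *.
    assert (0 < e + / e - 2 * cos a).
    { assert (E : e + / e - 2 = (e - 1) ^ 2 * / e) by (field; lra).
      assert (0 < / e) by now apply Rinv_0_lt_compat.
      generalize (pow2_ge_0 (e - 1)). nra. }
    assert (Hden : 0 < 1 + e * e - 2 * cos a * e)
      by (replace (1 + e * e - 2 * cos a * e) with (e * (e + / e - 2 * cos a)) by (field; lra); nra).
    assert (Hden2 : (1 + ((/ e - cos a) / sin a)²)
                    = (1 + e * e - 2 * cos a * e) / (e * e * (sin a * sin a))).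
    { unfold Rsqr.
      transitivity ((e * e * (sin a * sin a + cos a * cos a) + 1 - 2 * cos a * e)
                    / (e * e * (sin a * sin a))); [field; lra|].
      rewrite Hsc. f_equal. ring. }
    unfold Rsqr, Rdiv, Rminus in *. rewrite ?Rmult_1_r. rewrite Hden2. field.
    repeat split; try lra.
  - intros x. apply @ex_derive_continuous. auto_derive.
    generalize (cosh_ge_1 x). lra.
  - assert (Hat : atan ((0 - cos a) / sin a) = - (PI / 2 - a)).
    { replace ((0 - cos a) / sin a) with (- tan (PI / 2 - a)).
      - rewrite atan_opp, atan_tan by lra. ring.
      - unfold tan. rewrite sin_shift, cos_shift. field. lra. }
    replace (Finite (2 / sin a * (PI / 2 - a)))
      with (Finite ((fun y => - (2 / sin a) * atan ((y - cos a) / sin a)) 0))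
      by (simpl; rewrite Hat; f_equal; ring).
    apply (is_lim_comp_continuous (fun x => exp (- (1 * x)))
             (fun y => - (2 / sin a) * atan ((y - cos a) / sin a))).
    + apply is_lim_exp_decay. lra.
    + apply @ex_derive_continuous. auto_derive. trivial.
Qed.

Lemma half_int_inv_cosh_sqr : half_int (fun x => / (cosh x * cosh x)) 1.
Proof.
  (* This is 1 + tanh x, in a form whose limit at infinity is immediate. *)
  set (F := fun x => 2 / (1 + exp (- (2 * x)))).
  replace 1 with (2 / (1 + 0) - F 0)
    by (unfold F; rewrite Rmult_0_r, Ropp_0, exp_0; field).
  apply half_int_derive.
  - intros x. unfold F. generalize (exp_pos (- (2 * x))). intros H.
    auto_derive; [lra|].
    replace (- (2 * x)) with (- x + - x) in * by ring. rewrite exp_plus in *.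
    unfold cosh. rewrite exp_Ropp in *. assert (He := exp_pos x). field.
    split; nra.
  - intros x. apply @ex_derive_continuous. auto_derive. generalize (cosh_ge_1 x). nra.
  - apply (is_lim_comp_continuous (fun x => exp (- (2 * x))) (fun y => 2 / (1 + y))).
    + apply is_lim_exp_decay. lra.
    + apply @ex_derive_continuous. auto_derive. lra.
Qed.

(* The summand with coinciding poles vanishes, as Rocq's [/ 0] is [0]. *)
Definition cofactor (n m k : nat) : R :=
  rsum (fun l => weight m l * / (cos (node n k) - cos (node m l))) m.

(** Collects the products of residues over pairs of equal roots; these pairs supply the multiple of
    1 / X^2, because a common root is required to be 0 wherever this coefficient is used. *)
Definition double_pole_coef (n m : nat) : R :=
  rsum (fun k => rsum (fun l => weight n k * weight m l *
    (if Req_EM_T (cos (node n k)) (cos (node m l)) then 1 else 0)) m) n.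

(** Integral of the simple fractions at the roots of T_n: the factor sin a_k of the residue cancels
    the denominator of (pi - a_k) / sin a_k. *)
Definition pole_sum (n m : nat) : R :=
  / INR n * rsum (fun k => (-1) ^ k * cofactor n m k * (PI - node n k)) n.

(** One formula covers both cases: if c = d, the first term vanishes by the convention [/ 0 = 0],
    and the product is 1 / X^2 because a common root must be 0. *)
Lemma inv_mult_partial_fractions X c d :
  X - c <> 0 -> X - d <> 0 -> (c = d -> c = 0) ->
  / (X - c) * / (X - d) =
  (/ (X - c) - / (X - d)) * / (c - d) + (if Req_EM_T c d then 1 else 0) * / (X * X).
Proof.
  intros Hc Hd H. destruct (Req_EM_T c d) as [E|E].
  - specialize (H E). subst d. subst c. rewrite Rminus_0_r in *.
    rewrite Rinv_mult. ring.
  - rewrite Rmult_0_l, Rplus_0_r. field. repeat split; try assumption. lra.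
Qed.

Lemma inv_cosh_mult_partial_fractions n m x :
  (1 <= n)%nat -> (1 <= m)%nat ->
  (forall k l, (k < n)%nat -> (l < m)%nat ->
     cos (node n k) = cos (node m l) -> cos (node n k) = 0) ->
  / (cosh (INR n * x) * cosh (INR m * x)) =
  rsum (fun k => weight n k * cofactor n m k * / (cosh x - cos (node n k))) n +
  rsum (fun l => weight m l * cofactor m n l * / (cosh x - cos (node m l))) m +
  double_pole_coef n m * / (cosh x * cosh x).
Proof.
  intros Hn Hm H.
  rewrite Rinv_mult, <- !inv_cosh_partial_fractions, rsum_mult by assumption.
  set (X := cosh x). assert (HX : 1 <= X) by apply cosh_ge_1.
  set (A := fun k => / (X - cos (node n k))). set (B := fun l => / (X - cos (node m l))).
  rewrite (rsum_ext _ (fun k => weight n k * cofactor n m k * A k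
     + rsum (fun l => weight m l * B l *
               (weight n k * / (cos (node m l) - cos (node n k)))) m
     + rsum (fun l => weight n k * weight m l *
            (if Req_EM_T (cos (node n k)) (cos (node m l)) then 1 else 0)) m * / (X * X))).
  - rewrite !rsum_plus, rsum_swap. f_equal; [f_equal|].
    + apply rsum_ext. intros l _. rewrite rsum_scal. fold (B l).
      unfold cofactor. ring.
    + unfold double_pole_coef. rewrite (Rmult_comm _ (/ _)), <- rsum_scal.
      apply rsum_ext. intros k _. ring.
  - intros k Hk. unfold cofactor.
    replace (weight n k * rsum (fun l => weight m l * / (cos (node n k) - cos (node m l))) m * A k)
      with ((weight n k * A k) * rsum (fun l => weight m l * / (cos (node n k) - cos (node m l))) m)
      by ring.
    rewrite (Rmult_comm _ (/ (X * X))), <- !rsum_scal, <- !rsum_plus.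
    apply rsum_ext. intros l Hl. fold (A k) (B l).
    replace (weight n k * A k * (weight m l * B l))
      with (weight n k * weight m l * (A k * B l)) by ring.
    unfold A at 1, B at 1. rewrite inv_mult_partial_fractions.
    + fold (A k) (B l).
      replace (cos (node m l) - cos (node n k)) with (- (cos (node n k) - cos (node m l))) by ring.
      rewrite Rinv_opp. ring.
    + generalize (node_cos_lt_1 _ _ Hk). lra.
    + generalize (node_cos_lt_1 _ _ Hl). lra.
    + apply H; assumption.
Qed.

Lemma half_int_inv_cosh_mult n m :
  (1 <= n)%nat -> (1 <= m)%nat ->
  (forall k l, (k < n)%nat -> (l < m)%nat ->
     cos (node n k) = cos (node m l) -> cos (node n k) = 0) ->
  half_int (fun x => / (cosh (INR n * x) * cosh (INR m * x)))
           (pole_sum n m + pole_sum m n + double_pole_coef n m).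
Proof.
  intros Hn Hm H.
  assert (Hpart : forall n m, (1 <= n)%nat ->
    half_int (fun x => rsum (fun k => weight n k * cofactor n m k * / (cosh x - cos (node n k))) n)
             (pole_sum n m)).
  { clear. intros n m Hn. assert (HnR := INR_pos n Hn). unfold pole_sum.
    rewrite <- rsum_scal.
    apply (half_int_rsum (fun k x => weight n k * cofactor n m k * / (cosh x - cos (node n k)))).
    intros k Hk. assert (Hs := sin_node_pos n k Hk).
    replace (/ INR n * ((-1) ^ k * cofactor n m k * (PI - node n k)))
      with (weight n k * cofactor n m k * ((PI - node n k) / sin (node n k)))
      by (unfold weight; field; lra).
    apply half_int_scal, half_int_inv_cosh_sub_cos, node_bounds, Hk. }
  apply (half_int_ext (fun x =>
    rsum (fun k => weight n k * cofactor n m k * / (cosh x - cos (node n k))) n +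
    rsum (fun l => weight m l * cofactor m n l * / (cosh x - cos (node m l))) m +
    double_pole_coef n m * / (cosh x * cosh x))).
  - intros x. symmetry. now apply inv_cosh_mult_partial_fractions.
  - replace (pole_sum n m + pole_sum m n + double_pole_coef n m)
      with (pole_sum n m + pole_sum m n + double_pole_coef n m * 1) by ring.
    repeat apply half_int_plus; try (apply Hpart; assumption).
    apply half_int_scal, half_int_inv_cosh_sqr.
Qed.

(** The partial fractions of 1 / T_m, now read at the argument cos a of a root of T_n, where T_m
    (cos a) = cos (m a). *)
Lemma cofactor_eq n m k :
  (1 <= m)%nat -> cos (INR m * node n k) <> 0 ->
  cofactor n m k = / cos (INR m * node n k).
Proof. apply inv_cos_partial_fractions. Qed.

(** * Reflection of the nodes and the parity of n + m *)

Lemma node_rev n k : (k < n)%nat -> node n (n - 1 - k) = PI - node n k.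
Proof.
  intros Hk. assert (Hn := INR_pos n ltac:(lia)). unfold node.
  rewrite !minus_INR by lia. simpl (INR 1). field. lra.
Qed.

Lemma pow_m1_rev n k : (k < n)%nat -> (-1) ^ (n - 1 - k) = (-1) ^ (n - 1) * (-1) ^ k.
Proof.
  intros Hk. replace (n - 1)%nat with ((n - 1 - k) + k)%nat at 2 by lia.
  rewrite pow_add, Rmult_assoc, pow_m1_sqr. ring.
Qed.

Lemma weight_rev n k : (k < n)%nat -> weight n (n - 1 - k) = (-1) ^ (n - 1) * weight n k.
Proof.
  intros Hk. unfold weight. rewrite node_rev, pow_m1_rev, sin_PI_x by exact Hk.
  unfold Rdiv. ring.
Qed.

(** The parity T_m (- c) = (-1)^m T_m (c). Working on the sum of fractions, not on its value, keeps
    it valid at a root common to T_n and T_m. *)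
Lemma cofactor_rev n m k :
  (k < n)%nat -> (1 <= m)%nat -> cofactor n m (n - 1 - k) = (-1) ^ m * cofactor n m k.
Proof.
  intros Hk Hm. unfold cofactor. rewrite rsum_rev, <- rsum_scal.
  apply rsum_ext. intros l Hl. rewrite weight_rev, !node_rev by assumption.
  rewrite !Rtrigo_facts.cos_pi_minus.
  replace (- cos (node n k) - - cos (node m l)) with (- (cos (node n k) - cos (node m l))) by ring.
  rewrite Rinv_opp. destruct m as [|p]; [lia|].
  replace (S p - 1)%nat with p by lia. simpl. ring.
Qed.

Lemma pow_m1_even k : Nat.Even k -> (-1) ^ k = 1.
Proof. intros [q ->]. apply pow_1_even. Qed.

Lemma pow_m1_odd k : Nat.Odd k -> (-1) ^ k = -1.
Proof. intros [q ->]. replace (2 * q + 1)%nat with (S (2 * q)) by lia. apply pow_1_odd. Qed.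

Lemma rev_sign n m k :
  (k < n)%nat -> (1 <= m)%nat ->
  (-1) ^ (n - 1 - k) * cofactor n m (n - 1 - k)
  = - (-1) ^ (n + m) * ((-1) ^ k * cofactor n m k).
Proof.
  intros Hk Hm. rewrite pow_m1_rev, cofactor_rev, pow_add by assumption.
  destruct n as [|p]; [lia|]. replace (S p - 1)%nat with p by lia. simpl. ring.
Qed.

(** The terms k and n - 1 - k carry equal coefficients, so pi - a_k may be replaced by its average
    with a_k, that is by pi / 2. *)
Lemma pole_sum_odd n m :
  (1 <= n)%nat -> (1 <= m)%nat -> Nat.Odd (n + m) ->
  pole_sum n m = PI / (2 * INR n) * rsum (fun k => (-1) ^ k * cofactor n m k) n.
Proof.
  intros Hn Hm Ho. assert (HnR := INR_pos n Hn). unfold pole_sum.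
  set (S1 := rsum (fun k => (-1) ^ k * cofactor n m k * (PI - node n k)) n).
  assert (E : 2 * S1 = PI * rsum (fun k => (-1) ^ k * cofactor n m k) n).
  { replace (2 * S1) with (S1 + S1) by ring. unfold S1 at 2. rewrite rsum_rev.
    unfold S1. rewrite <- rsum_plus, <- rsum_scal. apply rsum_ext. intros k Hk.
    rewrite rev_sign, node_rev, (pow_m1_odd (n + m)) by assumption. ring. }
  replace S1 with (2 * S1 / 2) by field. rewrite E. field. lra.
Qed.

(** The terms k and n - 1 - k now carry opposite coefficients, so the constant part of pi - a_k
    drops out and only - pi k / n survives: this is where the factor k of the even case comes
    from. *)
Lemma pole_sum_even n m :
  (1 <= n)%nat -> (1 <= m)%nat -> Nat.Even (n + m) ->
  pole_sum n m = - (PI / (INR n * INR n)) * rsum (fun k => (-1) ^ k * cofactor n m k * INR k) n.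
Proof.
  intros Hn Hm Ho. assert (HnR := INR_pos n Hn). unfold pole_sum.
  set (S0 := rsum (fun k => (-1) ^ k * cofactor n m k) n).
  assert (E : S0 = 0).
  { enough (S0 = - S0) by lra. unfold S0 at 1. rewrite rsum_rev.
    replace (- S0) with (-1 * S0) by ring. unfold S0. rewrite <- rsum_scal.
    apply rsum_ext. intros k Hk. rewrite rev_sign, (pow_m1_even (n + m)) by assumption. ring. }
  rewrite (rsum_ext _ (fun k => (PI - PI / (2 * INR n)) * ((-1) ^ k * cofactor n m k)
            + (- (PI / INR n)) * ((-1) ^ k * cofactor n m k * INR k))).
  - rewrite rsum_plus, !rsum_scal. fold S0. rewrite E. field. lra.
  - intros k Hk. unfold node. field. lra.
Qed.

(** * Common roots of T_n and T_m, and the closed forms *)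

Lemma cos_term_node n m k : Defs.cos_term n m k = cos (INR m * node n k).
Proof. unfold Defs.cos_term, node. f_equal. ring. Qed.

Lemma cos_eq_0_half_odd q p :
  (1 <= q)%nat -> cos (INR p / (2 * INR q) * PI) = 0 ->
  exists j, (p = (2 * j + 1) * q)%nat.
Proof.
  intros Hq H. assert (HqR := INR_pos q Hq).
  apply cos_eq_0_0 in H. destruct H as [z Hz].
  assert (E : INR p = (2 * IZR z + 1) * INR q).
  { assert (Hpi := PI_RGT_0).
    apply Rmult_eq_reg_r with PI; [|lra].
    transitivity (2 * INR q * (INR p / (2 * INR q) * PI)); [field; lra|]. rewrite Hz. field. }
  rewrite !INR_IZR_INZ, <- mult_IZR, <- plus_IZR, <- mult_IZR in E. apply eq_IZR in E.
  assert (Hz0 : (0 <= z)%Z) by nia.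
  exists (Z.to_nat z). apply Nat2Z.inj. rewrite E, Nat2Z.inj_mul. f_equal. lia.
Qed.

Lemma cos_term_eq_0 n m k :
  (1 <= n)%nat -> cos (INR m * node n k) = 0 ->
  exists j, ((1 + 2 * k) * m = (2 * j + 1) * n)%nat.
Proof.
  intros Hn H. apply cos_eq_0_half_odd; [exact Hn|].
  rewrite <- H. f_equal. unfold node. rewrite mult_INR, plus_INR, mult_INR. simpl. field.
  generalize (INR_pos n Hn). lra.
Qed.

Lemma cos_node_eq n m k l :
  (k < n)%nat -> (l < m)%nat -> cos (node n k) = cos (node m l) ->
  ((1 + 2 * k) * m = (1 + 2 * l) * n)%nat.
Proof.
  intros Hk Hl H.
  assert (HnR := INR_pos n ltac:(lia)). assert (HmR := INR_pos m ltac:(lia)).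
  assert (E : node n k = node m l).
  { apply node_bounds in Hk. apply node_bounds in Hl. apply cos_inj; auto; lra. }
  apply INR_eq. rewrite !mult_INR, !plus_INR, !mult_INR. change (INR 1) with 1. change (INR 2) with 2.
  assert (Hpi := PI_RGT_0). apply Rmult_eq_reg_r with PI; [|lra].
  transitivity (2 * INR n * INR m * node n k); [unfold node; field; lra|].
  rewrite E. unfold node. field. lra.
Qed.

(** An odd multiple of n equals an odd multiple of m only when n and m have the same parity. So here
    all poles are simple and no denominator of [sum_odd] vanishes. *)
Lemma half_int_odd n m :
  (1 <= n)%nat -> (1 <= m)%nat -> Nat.Odd (n + m) ->
  half_int (fun x => / (cosh (INR n * x) * cosh (INR m * x)))
    (PI / (2 * INR n) * sum_odd n m + PI / (2 * INR m) * sum_odd m n).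
Proof.
  intros Hn Hm Ho.
  assert (Hne : forall k l, (k < n)%nat -> (l < m)%nat -> cos (node n k) <> cos (node m l)).
  { intros k l Hk Hl E. apply cos_node_eq in E; try assumption.
    destruct Ho as [q Hq]. nia. }
  assert (Hpart : forall n m, (1 <= n)%nat -> (1 <= m)%nat -> Nat.Odd (n + m) ->
            pole_sum n m = PI / (2 * INR n) * sum_odd n m).
  { clear. intros n m Hn Hm Ho. rewrite pole_sum_odd by assumption. f_equal.
    unfold sum_odd. rewrite rsum_sum_f_R0 by exact Hn. apply rsum_ext. intros k Hk.
    rewrite cos_term_node, cofactor_eq; [reflexivity|exact Hm|].
    intros E. apply cos_term_eq_0 in E; [|exact Hn]. destruct E as [j Hj].
    destruct Ho as [q Hq]. nia. }
  rewrite <- !Hpart; auto; [|now rewrite Nat.add_comm].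
  replace (pole_sum n m + pole_sum m n)
    with (pole_sum n m + pole_sum m n + double_pole_coef n m).
  - apply half_int_inv_cosh_mult; auto. intros k l Hk Hl E. now destruct (Hne k l).
  - unfold double_pole_coef. rewrite rsum_zero; [ring|]. intros k Hk.
    apply rsum_zero. intros l Hl.
    destruct (Req_EM_T _ _) as [E|_]; [now destruct (Hne k l)|ring].
Qed.

Lemma node_center q : node (2 * q + 1) q = PI / 2.
Proof.
  unfold node. rewrite plus_INR, mult_INR. simpl. generalize (pos_INR q). intros. field. lra.
Qed.

(** The central node is its own reflection and T_m is odd, so the cofactor is its own negative.
    Hence omitting the central index in [sum_even] loses nothing. *)
Lemma cofactor_center q m : Nat.Odd m -> cofactor (2 * q + 1) m q = 0.
Proof.
  intros Hm. assert (H1 : (1 <= m)%nat) by (destruct Hm; lia).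
  assert (E := cofactor_rev (2 * q + 1) m q ltac:(lia) H1).
  replace (2 * q + 1 - 1 - q)%nat with q in E by lia.
  rewrite pow_m1_odd in E by exact Hm. lra.
Qed.

(** By coprimality 2 p + 1 divides 1 + 2 k, which is odd and below 2 (2 p + 1); so they are
    equal. *)
Lemma coprime_odd_multiple_center p q k j :
  Nat.gcd (2 * p + 1) (2 * q + 1) = 1%nat -> (k < 2 * p + 1)%nat ->
  ((1 + 2 * k) * (2 * q + 1) = (2 * j + 1) * (2 * p + 1))%nat -> k = p.
Proof.
  intros Hg Hk E.
  assert (D : Nat.divide (2 * p + 1) (1 + 2 * k)).
  { apply Nat.gauss with (2 * q + 1)%nat; [|exact Hg].
    exists (2 * j + 1)%nat. lia. }
  destruct D as [z Hz].
  destruct z as [|[|z]]; [lia|lia|nia].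
Qed.

Lemma half_int_even p q (n := (2 * p + 1)%nat) (m := (2 * q + 1)%nat) :
  Nat.gcd n m = 1%nat ->
  half_int (fun x => / (cosh (INR n * x) * cosh (INR m * x)))
    (- (PI / (INR n * INR n)) * sum_even n m - PI / (INR m * INR m) * sum_even m n
     + (-1) ^ (p + q) / (INR n * INR m)).
Proof.
  intros Hg.
  assert (Hcenter : forall k l, (k < n)%nat -> (l < m)%nat ->
            cos (node n k) = cos (node m l) -> k = p /\ l = q).
  { intros k l Hk Hl E. apply cos_node_eq in E; try assumption. split.
    - apply (coprime_odd_multiple_center p q k l); auto. unfold n, m in E. lia.
    - apply (coprime_odd_multiple_center q p l k); auto.
      + now rewrite Nat.gcd_comm.
      + unfold n, m in E. lia. }
  assert (Hpart : forall p q, Nat.gcd (2 * p + 1) (2 * q + 1) = 1%nat ->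
            pole_sum (2 * p + 1) (2 * q + 1) =
            - (PI / (INR (2 * p + 1) * INR (2 * p + 1))) * sum_even (2 * p + 1) (2 * q + 1)).
  { clear. intros p q Hg. rewrite pole_sum_even; [|lia|lia|exists (p + q + 1)%nat; lia]. f_equal.
    unfold sum_even. rewrite rsum_sum_f_R0 by lia. apply rsum_ext. intros k Hk.
    replace ((2 * p + 1 - 1) / 2)%nat with p
      by (replace (2 * p + 1 - 1)%nat with (p * 2)%nat by lia; symmetry; apply Nat.div_mul; lia).
    destruct (Nat.eqb_spec k p) as [->|Hne].
    - rewrite cofactor_center; [ring|]. exists q. lia.
    - rewrite cos_term_node, cofactor_eq; [unfold Rdiv; ring|lia|].
      intros E. apply Hne. apply cos_term_eq_0 in E; [|lia]. destruct E as [j Hj].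
      now apply (coprime_odd_multiple_center p q k j). }
  (* The only common root comes from the node pi / 2, where the residues are (-1)^p / n and (-1)^q /
     m. *)
  assert (Hdp : double_pole_coef n m = (-1) ^ (p + q) / (INR n * INR m)).
  { unfold double_pole_coef.
    assert (Hw : forall r, weight (2 * r + 1) r = (-1) ^ r / INR (2 * r + 1)).
    { intros r. unfold weight. rewrite node_center, sin_PI2. f_equal. ring. }
    assert (HnR : 0 < INR n) by (apply INR_pos; unfold n; lia).
    assert (HmR : 0 < INR m) by (apply INR_pos; unfold m; lia).
    rewrite (rsum_single _ n p); [rewrite (rsum_single _ m q)| |].
    - unfold n at 1 2, m at 1 2. rewrite !Hw.
      destruct (Req_EM_T _ _) as [_|E]; [|destruct E; now rewrite (node_center p), (node_center q)].
      fold n m. rewrite pow_add. field. lra.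
    - unfold m. lia.
    - intros l Hl Hne. destruct (Req_EM_T _ _) as [E|_]; [|ring].
      apply Hcenter in E; [now destruct E| |exact Hl]. unfold n. lia.
    - unfold n. lia.
    - intros k Hk Hne. apply rsum_zero. intros l Hl.
      destruct (Req_EM_T _ _) as [E|_]; [|ring].
      apply Hcenter in E; [now destruct E|exact Hk|exact Hl]. }
  replace (- (PI / (INR n * INR n)) * sum_even n m - PI / (INR m * INR m) * sum_even m n
     + (-1) ^ (p + q) / (INR n * INR m)) with (pole_sum n m + pole_sum m n + double_pole_coef n m).
  - apply half_int_inv_cosh_mult; [unfold n; lia|unfold m; lia|].
    intros k l Hk Hl E. destruct (Hcenter k l Hk Hl E) as [-> _].
    unfold n. now rewrite node_center, cos_PI2.
  - assert (P1 := Hpart p q Hg). rewrite Nat.gcd_comm in Hg. assert (P2 := Hpart q p Hg).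
    fold n m in P1, P2. rewrite Hdp, P1, P2. ring.
Qed.

(** * The Fourier transform of the hyperbolic secant *)

Lemma rsum_alternating_exp x K :
  rsum (fun k => (-1) ^ k * exp (- ((2 * INR k + 1) * x))) K =
  (1 - (-1) ^ K * exp (- (2 * INR K * x))) / (2 * cosh x).
Proof.
  assert (Hc := cosh_pos x).
  induction K as [|K IH].
  - simpl. rewrite Rmult_0_r, Rmult_0_l, Ropp_0, exp_0. field. lra.
  - cbn [rsum]. rewrite IH, S_INR. simpl pow.
    replace (- (2 * (INR K + 1) * x)) with (- (2 * INR K * x) + - x + - x) by ring.
    replace (- ((2 * INR K + 1) * x)) with (- (2 * INR K * x) + - x) by ring.
    rewrite !exp_plus.
    assert (E : 2 * cosh x * exp (- x) = 1 + exp (- x) * exp (- x)).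
    { unfold cosh. rewrite exp_Ropp. generalize (exp_pos x). intros. field. lra. }
    set (P := (-1) ^ K * exp (- (2 * INR K * x))).
    apply Rmult_eq_reg_r with (2 * cosh x); [|lra]. rewrite Rmult_plus_distr_r.
    transitivity (1 - P + P * (2 * cosh x * exp (- x))); [unfold P; field; lra|].
    rewrite E. unfold P. field. lra.
Qed.

(** * A Riemann-Lebesgue estimate for the cosine kernel *)

Lemma exp_le x y : x <= y -> exp x <= exp y.
Proof. intros [H| ->]; [left; now apply exp_increasing|apply Rle_refl]. Qed.

Lemma cosh_le_exp_Rabs x : cosh x <= exp (Rabs x).
Proof.
  unfold cosh.
  assert (exp x <= exp (Rabs x)) by (apply exp_le, Rle_abs).
  assert (exp (- x) <= exp (Rabs x)) by (apply exp_le; rewrite <- Rabs_Ropp; apply Rle_abs).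
  lra.
Qed.

Lemma sinh_mult_bound u y :
  0 <= y <= 1 -> Rabs (sinh (u * y)) <= Rabs u * exp (Rabs u) * y.
Proof.
  intros Hy.
  destruct (MVT_gen (fun y => sinh (u * y)) 0 y (fun y => u * cosh (u * y))) as [c [Hc E]].
  - intros x _. auto_derive; trivial. ring.
  - intros x _. apply continuity_pt_filterlim, (ex_derive_continuous (fun y => sinh (u * y))).
    now auto_derive.
  - rewrite Rmin_left, Rmax_right in Hc by lra.
    rewrite Rmult_0_r, sinh_0, !Rminus_0_r in E. rewrite E, !Rabs_mult.
    rewrite (Rabs_pos_eq y), (Rabs_pos_eq (cosh _)) by (generalize (cosh_pos (u * c)); lra).
    apply Rmult_le_compat_r; [lra|]. apply Rmult_le_compat_l; [apply Rabs_pos|].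
    eapply Rle_trans; [apply cosh_le_exp_Rabs|]. apply exp_le.
    rewrite Rabs_mult, (Rabs_pos_eq c) by lra. generalize (Rabs_pos u). nra.
Qed.

(** Vanishing to second order at y = 0 is what keeps both (cosh (u y) - 1) / sin (pi y) and its
    derivative bounded up to 0. *)
Lemma cosh_mult_sub_1_bound u y :
  0 <= y <= 1 -> 0 <= cosh (u * y) - 1 <= Rabs u * Rabs u * exp (Rabs u) * (y * y).
Proof.
  intros Hy. split; [generalize (cosh_ge_1 (u * y)); lra|].
  destruct (MVT_gen (fun y => cosh (u * y)) 0 y (fun y => u * sinh (u * y))) as [c [Hc E]].
  - intros x _. auto_derive; trivial. ring.
  - intros x _. apply continuity_pt_filterlim, (ex_derive_continuous (fun y => cosh (u * y))).
    now auto_derive.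
  - rewrite Rmin_left, Rmax_right in Hc by lra.
    rewrite Rmult_0_r, cosh_0, Rminus_0_r in E. rewrite E.
    eapply Rle_trans; [apply Rle_abs|]. rewrite !Rabs_mult, (Rabs_pos_eq y) by lra.
    assert (Hs : Rabs (sinh (u * c)) <= Rabs u * exp (Rabs u) * c)
      by (apply sinh_mult_bound; lra).
    assert (Hu := Rabs_pos u). assert (He := exp_pos (Rabs u)).
    assert (0 <= Rabs u * exp (Rabs u)) by nra.
    assert (Hs' : Rabs (sinh (u * c)) <= Rabs u * exp (Rabs u) * y) by nra.
    replace (Rabs u * Rabs u * exp (Rabs u) * (y * y))
      with (Rabs u * (Rabs u * exp (Rabs u) * y) * y) by ring.
    apply Rmult_le_compat_r; [lra|]. apply Rmult_le_compat_l; assumption.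
Qed.

(** A weak Jordan inequality. With z = pi y / 2 <= pi / 4 and r = cos (pi / 4), sin z >= r z and cos
    z >= r, so sin (2 z) >= 2 r^2 z = z >= y. *)
Lemma sin_PI_mult_ge y : 0 <= y <= 1 / 2 -> y <= sin (PI * y).
Proof.
  intros Hy. assert (Hpi := PI_RGT_0). assert (Hpi2 := PI2_1).
  set (z := PI * y / 2). assert (Hz : 0 <= z <= PI / 4) by (unfold z; nra).
  set (r := cos (PI / 4)).
  assert (Hr0 : 0 < r) by (apply cos_gt_0; lra).
  assert (Hr : r * r = / 2).
  { unfold r. rewrite cos_PI4. assert (Hq : sqrt 2 * sqrt 2 = 2) by (apply sqrt_sqrt; lra).
    assert (Hq0 : 0 < sqrt 2) by (apply sqrt_lt_R0; lra).
    transitivity (/ (sqrt 2 * sqrt 2)); [field; lra|now rewrite Hq]. }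
  assert (Hcos : forall c, 0 <= c <= z -> r <= cos c)
    by (intros c Hc; apply cos_decr_1; lra).
  assert (Hsz : r * z <= sin z).
  { destruct (MVT_gen sin 0 z cos) as [c [Hc E]].
    - intros x _. auto_derive; trivial. ring.
    - intros x _. apply continuity_sin.
    - rewrite Rmin_left, Rmax_right in Hc by lra.
      rewrite sin_0, !Rminus_0_r in E. rewrite E.
      apply Rmult_le_compat_r; [lra|auto]. }
  assert (Hcz : r <= cos z) by (apply Hcos; lra).
  replace (PI * y) with (2 * z) by (unfold z; field). rewrite sin_2a.
  assert (r * z * r <= sin z * cos z) by (apply Rmult_le_compat; try assumption; nra).
  replace (r * z * r) with (r * r * z) in * by ring.
  rewrite Hr in *. unfold z in *. nra.
Qed.

(* Integration by parts away from the removable singularity at 0. *)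
Lemma riemann_lebesgue_sech_bound u : exists C, forall K : nat, (1 <= K)%nat ->
  Rabs (RInt (fun y => (cosh (u * y) - 1) *
                       rsum (fun k => cos ((2 * INR k + 1) * (PI * y))) K) 0 (1 / 2))
  <= C / INR K.
Proof.
  set (A1 := Rabs u * Rabs u * exp (Rabs u)).
  assert (HA1 : 0 <= A1).
  { unfold A1. generalize (Rabs_pos u) (exp_pos (Rabs u)). intros. apply Rmult_le_pos; nra. }
  set (A2 := A1 + A1 * PI).
  (* [A1] pays for the piece near 0, [2 * A1] for the two boundary terms, [A2] for the integral
     containing the derivative of [g]. *)
  exists (A1 + 2 * A1 + A2). intros K HK. assert (HKR := INR_pos K HK).
  assert (Hpi := PI_RGT_0). assert (Hpi2 := PI2_1).
  set (f := fun y => (cosh (u * y) - 1) * rsum (fun k => cos ((2 * INR k + 1) * (PI * y))) K).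
  assert (Hf : forall x, continuous f x).
  { intros x. apply (continuous_mult (fun y => cosh (u * y) - 1)).
    - apply @ex_derive_continuous. now auto_derive.
    - apply (continuous_rsum (fun k y => cos ((2 * INR k + 1) * (PI * y)))).
      intros k _. apply @ex_derive_continuous. now auto_derive. }
  set (g := fun y => (cosh (u * y) - 1) / (2 * sin (PI * y))).
  assert (Hfg : forall y, 0 < y <= 1 / 2 -> f y = g y * sin (2 * INR K * (PI * y))).
  { intros y Hy. assert (Hs : y <= sin (PI * y)) by (apply sin_PI_mult_ge; lra).
    unfold f, g. rewrite <- rsum_cos_odd. field. lra. }
  assert (Hg : forall y, 0 < y <= 1 / 2 -> 0 <= g y <= A1).
  { intros y Hy. assert (Hs : y <= sin (PI * y)) by (apply sin_PI_mult_ge; lra).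
    assert (Hc : 0 <= cosh (u * y) - 1 <= A1 * (y * y)) by (apply cosh_mult_sub_1_bound; lra).
    unfold g. split; [apply Rdiv_le_0_compat; lra|].
    apply Rmult_le_reg_r with (2 * sin (PI * y)); [lra|].
    replace ((cosh (u * y) - 1) / (2 * sin (PI * y)) * (2 * sin (PI * y)))
      with (cosh (u * y) - 1) by (field; lra).
    assert (A1 * (y * y) <= A1 * (2 * sin (PI * y))) by (apply Rmult_le_compat_l; nra). lra. }
  (* The quotient [g] is not usable at 0, where it divides by sin 0. Below the cutoff [e] the
     integrand is at most [A1], so that piece is O(1 / K) by its length alone. *)
  set (e := / (2 * INR K)).
  assert (HK1 : 1 <= INR K) by (change 1 with (INR 1); apply le_INR; lia).
  assert (He : 0 < e <= 1 / 2).
  { unfold e. split; [apply Rinv_0_lt_compat; lra|].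
    replace (1 / 2) with (/ 2) by field. apply Rinv_le_contravar; lra. }
  assert (HeK : e = / INR K / 2) by (unfold e; field; lra).
  assert (H1 : Rabs (RInt f 0 e) <= A1 / INR K).
  { eapply Rle_trans; [apply (abs_RInt_le_const f 0 e A1)|].
    - lra.
    - apply continuous_ex_RInt, Hf.
    - intros t Ht. destruct (Req_dec t 0) as [->|Hne].
      + unfold f. rewrite Rmult_0_r, cosh_0. rewrite Rminus_diag, Rmult_0_l, Rabs_R0. exact HA1.
      + rewrite Hfg, Rabs_mult by lra.
        assert (Hgt : 0 <= g t <= A1) by (apply Hg; lra).
        rewrite (Rabs_pos_eq (g t)) by lra.
        assert (Rabs (sin (2 * INR K * (PI * t))) <= 1) by (apply Rabs_le, SIN_bound).
        generalize (Rabs_pos (sin (2 * INR K * (PI * t)))). nra.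
    - rewrite Rminus_0_r, HeK. unfold Rdiv.
      assert (0 < / INR K) by now apply Rinv_0_lt_compat. nra. }
  set (w := 2 * INR K * PI). assert (Hw : 2 * INR K <= w) by (unfold w; nra).
  set (dg := fun y => u * sinh (u * y) / (2 * sin (PI * y))
                      - (cosh (u * y) - 1) * (PI * cos (PI * y)) / (2 * (sin (PI * y) * sin (PI * y)))).
  assert (Hdg : forall y, 0 < y <= 1 / 2 -> Rabs (dg y) <= A2).
  { intros y Hy. assert (Hs : y <= sin (PI * y)) by (apply sin_PI_mult_ge; lra).
    assert (Hc : 0 <= cosh (u * y) - 1 <= A1 * (y * y)) by (apply cosh_mult_sub_1_bound; lra).
    assert (Hsh : Rabs (sinh (u * y)) <= Rabs u * exp (Rabs u) * y) by (apply sinh_mult_bound; lra).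
    unfold dg, A2. eapply Rle_trans; [apply Rabs_triang|]. rewrite Rabs_Ropp.
    unfold Rdiv. rewrite !Rabs_mult.
    rewrite (Rabs_pos_eq (cosh _ - 1)), (Rabs_pos_eq PI) by lra.
    rewrite !Rabs_inv, !Rabs_mult, (Rabs_pos_eq 2), (Rabs_pos_eq (sin _)) by lra.
    set (s := sin (PI * y)) in *.
    assert (Hcos : Rabs (cos (PI * y)) <= 1) by (apply Rabs_le, COS_bound).
    apply Rplus_le_compat.
    - apply Rmult_le_reg_r with (2 * s); [lra|].
      rewrite Rmult_assoc, Rinv_l, Rmult_1_r by lra.
      apply Rle_trans with (Rabs u * (Rabs u * exp (Rabs u) * y)).
      + apply Rmult_le_compat_l; [apply Rabs_pos|exact Hsh].
      + unfold A1. replace (Rabs u * (Rabs u * exp (Rabs u) * y)) with (A1 * y) by (unfold A1; ring).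
        fold A1. apply Rmult_le_compat_l; lra.
    - apply Rmult_le_reg_r with (2 * (s * s)); [nra|].
      rewrite Rmult_assoc, Rinv_l, Rmult_1_r by nra.
      apply Rle_trans with (A1 * (y * y) * (PI * 1)).
      + apply Rmult_le_compat; try lra.
        * apply Rmult_le_pos; [lra|apply Rabs_pos].
        * apply Rmult_le_compat_l; lra.
      + replace (A1 * (y * y) * (PI * 1)) with (A1 * PI * (y * y)) by ring.
        apply Rmult_le_compat_l; nra. }
  assert (Hsp : forall y, Rmin e (1 / 2) <= y <= Rmax e (1 / 2) -> 0 < sin (PI * y) /\ 0 < y <= 1 / 2).
  { intros y. rewrite Rmin_left, Rmax_right by lra. intros Hy.
    assert (y <= sin (PI * y)) by (apply sin_PI_mult_ge; lra). lra. }
  (* The boundary term of the integration by parts: its derivative is the integrand g sin (w y) up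
     to [dg y * cos (w * y) / w], which is O(1 / w). *)
  set (F := fun y => - (g y * cos (w * y)) / w).
  set (dF := fun y => g y * sin (w * y) - dg y * cos (w * y) / w).
  assert (HdF : forall y, Rmin e (1 / 2) <= y <= Rmax e (1 / 2) -> is_derive F y (dF y)).
  { intros y Hy. apply Hsp in Hy. unfold F, dF, g, dg. auto_derive; [lra|]. field. lra. }
  assert (HcdF : forall y, Rmin e (1 / 2) <= y <= Rmax e (1 / 2) -> continuous dF y).
  { intros y Hy. apply Hsp in Hy. unfold dF, g, dg. apply @ex_derive_continuous.
    auto_derive. repeat split; try lra. nra. }
  assert (HI := @is_RInt_derive R_CompleteNormedModule F dF e (1 / 2) HdF HcdF).
  assert (HexdF : ex_RInt dF e (1 / 2)) by (eexists; exact HI).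
  assert (Hexf : ex_RInt f e (1 / 2)) by apply continuous_ex_RInt, Hf.
  assert (H2 : Rabs (RInt f e (1 / 2) - RInt dF e (1 / 2)) <= A2 / w).
  { replace (RInt f e (1 / 2) - RInt dF e (1 / 2))
      with (RInt (fun y => minus (f y) (dF y)) e (1 / 2))
      by (apply (RInt_minus f dF); assumption).
    eapply Rle_trans; [apply (abs_RInt_le_const _ e (1 / 2) (A2 / w))|].
    - lra.
    - apply (ex_RInt_minus f dF); assumption.
    - intros t Ht. unfold minus, plus, opp; simpl. rewrite Hfg by lra.
      unfold dF. replace (2 * INR K * (PI * t)) with (w * t) by (unfold w; ring).
      replace (g t * sin (w * t) + - (g t * sin (w * t) - dg t * cos (w * t) / w))
        with (dg t * cos (w * t) / w) by ring.
      unfold Rdiv. rewrite !Rabs_mult, (Rabs_pos_eq (/ w)) by (left; apply Rinv_0_lt_compat; lra).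
      apply Rmult_le_compat_r; [left; apply Rinv_0_lt_compat; lra|].
      assert (Hd : Rabs (dg t) <= A2) by (apply Hdg; lra).
      assert (Rabs (cos (w * t)) <= 1) by (apply Rabs_le, COS_bound).
      generalize (Rabs_pos (cos (w * t))) (Rabs_pos (dg t)). nra.
    - assert (0 <= A2) by (unfold A2; nra).
      assert (0 <= A2 / w) by (apply Rdiv_le_0_compat; lra). nra. }
  assert (HF : forall y, 0 < y <= 1 / 2 -> Rabs (F y) <= A1 / w).
  { intros y Hy. unfold F, Rdiv. rewrite Rabs_mult, Rabs_Ropp, Rabs_mult.
    rewrite (Rabs_pos_eq (/ w)) by (left; apply Rinv_0_lt_compat; lra).
    apply Rmult_le_compat_r; [left; apply Rinv_0_lt_compat; lra|].
    assert (Hgy := Hg y Hy). rewrite (Rabs_pos_eq (g y)) by lra.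
    assert (Rabs (cos (w * y)) <= 1) by (apply Rabs_le, COS_bound).
    generalize (Rabs_pos (cos (w * y))). nra. }
  rewrite (is_RInt_unique dF _ _ _ HI) in H2.
  unfold minus, plus, opp in H2; simpl in H2.
  assert (HF1 := HF (1 / 2) ltac:(lra)). assert (HF2 := HF e He).
  assert (HC : RInt f 0 (1 / 2) = RInt f 0 e + RInt f e (1 / 2))
    by (symmetry; apply (RInt_Chasles f); apply continuous_ex_RInt, Hf).
  rewrite HC.
  assert (Hw1 : / w <= / INR K) by (apply Rinv_le_contravar; lra).
  assert (A1 / w <= A1 / INR K) by (apply Rmult_le_compat_l; assumption).
  assert (A2 / w <= A2 / INR K) by (apply Rmult_le_compat_l; [unfold A2; nra|assumption]).
  replace ((A1 + 2 * A1 + A2) / INR K) with (A1 / INR K + 2 * (A1 / INR K) + A2 / INR K)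
    by (field; lra).
  apply Rabs_le_between in H1. apply Rabs_le_between in H2.
  apply Rabs_le_between in HF1. apply Rabs_le_between in HF2.
  apply Rabs_le. lra.
Qed.

(** Since b / (u^2 + b^2) is the half-line integral of exp (- b t) cos (u t), this is half the
    integral of cos (u t) against K terms of the exponential series of 1 / cosh (pi t). *)
Definition sech_partial (u : R) (K : nat) : R :=
  rsum (fun k => (-1) ^ k * (((2 * INR k + 1) * PI) /
                 (u * u + ((2 * INR k + 1) * PI) * ((2 * INR k + 1) * PI)))) K.

Lemma odd_PI_pos k : 0 < (2 * INR k + 1) * PI.
Proof. generalize (pos_INR k) PI_RGT_0. nra. Qed.

(** At y = 1/2 the angles are odd multiples of pi / 2: the cosine terms vanish, the sines give
    (-1)^k, and the factor cosh (u / 2) is common to all terms. *)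
Lemma RInt_cosh_cos u K :
  RInt (fun y => cosh (u * y) * rsum (fun k => cos ((2 * INR k + 1) * (PI * y))) K) 0 (1 / 2)
  = cosh (u / 2) * sech_partial u K.
Proof.
  set (F := fun y => rsum (fun k => let b := (2 * INR k + 1) * PI in
     (u * sinh (u * y) * cos (b * y) + b * cosh (u * y) * sin (b * y)) / (u * u + b * b)) K).
  assert (HI : is_RInt (fun y => cosh (u * y) * rsum (fun k => cos ((2 * INR k + 1) * (PI * y))) K)
                 0 (1 / 2) (minus (F (1 / 2)) (F 0))).
  { apply @is_RInt_derive.
    - intros y _. unfold F. clear F. induction K as [|K IH].
      + simpl. rewrite Rmult_0_r. apply @is_derive_const.
      + cbn [rsum]. rewrite Rmult_plus_distr_l. apply @is_derive_plus; [exact IH|].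
        assert (Hb := odd_PI_pos K). simpl.
        replace ((2 * INR K + 1) * (PI * y)) with ((2 * INR K + 1) * PI * y) by ring.
        set (b := (2 * INR K + 1) * PI) in *. auto_derive; [nra|]. field. nra.
    - intros y _. apply (continuous_mult (fun y => cosh (u * y))).
      + apply @ex_derive_continuous. now auto_derive.
      + apply (continuous_rsum (fun k y => cos ((2 * INR k + 1) * (PI * y)))).
        intros k _. apply @ex_derive_continuous. now auto_derive. }
  rewrite (is_RInt_unique _ _ _ _ HI). unfold minus, plus, opp; simpl. unfold F.
  rewrite (rsum_zero (fun k => let b := (2 * INR k + 1) * PI in
     (u * sinh (u * 0) * cos (b * 0) + b * cosh (u * 0) * sin (b * 0)) / (u * u + b * b))).
  - rewrite Ropp_0, Rplus_0_r. unfold sech_partial. rewrite <- rsum_scal.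
    apply rsum_ext. intros k _. assert (Hb := odd_PI_pos k). simpl.
    replace ((2 * INR k + 1) * PI * (1 / 2)) with (INR k * PI + PI / 2) by field.
    rewrite sin_plus, cos_plus, sin_PI2, cos_PI2, (proj1 (sin_cos_kpi k)), (proj2 (sin_cos_kpi k)).
    replace (u * (1 / 2)) with (u / 2) by field. field. nra.
  - intros k _. simpl. assert (Hb := odd_PI_pos k). rewrite !Rmult_0_r, sinh_0, sin_0. field. nra.
Qed.

(** At u = 0 the terms are (-1)^k / ((2 k + 1) pi), so this is the Leibniz series for pi / 4 divided
    by pi. *)
Lemma sech_partial_0_lim : is_lim_seq (sech_partial 0) (/ 4).
Proof.
  assert (H := Alt_PI_eq). unfold Alt_PI in H. destruct exist_PI as [l Hl].
  apply is_lim_seq_Reals in Hl.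
  apply is_lim_seq_incr_1.
  replace (/ 4) with (/ PI * l) by (rewrite <- H; generalize PI_RGT_0; intros; field; lra).
  apply (is_lim_seq_ext (fun N => / PI * sum_f_R0 (tg_alt PI_tg) N)).
  - intros N. replace N with (S N - 1)%nat at 1 by lia.
    rewrite rsum_sum_f_R0 by lia. unfold sech_partial. rewrite <- rsum_scal.
    apply rsum_ext. intros k _. unfold tg_alt, PI_tg.
    rewrite plus_INR, mult_INR. simpl. generalize (pos_INR k) PI_RGT_0. intros. field.
    split; [lra|]. nra.
  - apply (is_lim_seq_scal_l _ (/ PI) l Hl).
Qed.

(** The kernel concentrates at y = 0, where cosh (u y) equals 1. Subtracting the case u = 0 leaves
    cosh (u y) - 1, to which the Riemann-Lebesgue bound applies. *)
Lemma sech_partial_lim u : is_lim_seq (sech_partial u) (/ (4 * cosh (u / 2))).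
Proof.
  assert (Hc := cosh_pos (u / 2)).
  set (Rm := fun K => RInt (fun y => (cosh (u * y) - 1) *
                       rsum (fun k => cos ((2 * INR k + 1) * (PI * y))) K) 0 (1 / 2)).
  assert (HR : is_lim_seq Rm 0).
  { destruct (riemann_lebesgue_sech_bound u) as [C HC].
    apply (is_lim_seq_incr_1 Rm).
    assert (HS : is_lim_seq (fun n => INR (S n)) p_infty)
      by (apply (is_lim_seq_incr_1 INR), is_lim_seq_INR).
    assert (H0 : is_lim_seq (fun n => C / INR (S n)) 0).
    { replace (Finite 0) with (Rbar_mult C 0) by (simpl; f_equal; ring).
      apply (is_lim_seq_scal_l _ C 0).
      apply (is_lim_seq_inv _ p_infty) in HS; [exact HS|discriminate]. }
    apply (is_lim_seq_le_le (fun n => - (C / INR (S n))) _ (fun n => C / INR (S n))).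
    - intros n. apply Rabs_le_between, HC. lia.
    - replace (Finite 0) with (Rbar_opp 0) by (simpl; f_equal; ring).
      now apply is_lim_seq_opp in H0.
    - exact H0. }
  apply (is_lim_seq_ext (fun K => / cosh (u / 2) * (sech_partial 0 K + Rm K))).
  - intros K.
    assert (E : Rm K = cosh (u / 2) * sech_partial u K - sech_partial 0 K).
    { rewrite <- RInt_cosh_cos.
      replace (sech_partial 0 K) with (cosh (0 / 2) * sech_partial 0 K)
        by (unfold Rdiv; rewrite Rmult_0_l, cosh_0; ring).
      rewrite <- RInt_cosh_cos.
      assert (Hcont : forall v x, continuous (fun y => cosh (v * y) *
                rsum (fun k => cos ((2 * INR k + 1) * (PI * y))) K) x).
      { intros v x. apply (continuous_mult (fun y => cosh (v * y))).
        - apply @ex_derive_continuous. now auto_derive.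
        - apply (continuous_rsum (fun k y => cos ((2 * INR k + 1) * (PI * y)))).
          intros k _. apply @ex_derive_continuous. now auto_derive. }
      symmetry.
      etransitivity; [symmetry; refine (RInt_minus _ _ 0 (1 / 2) _ _);
                      apply continuous_ex_RInt, Hcont|].
      unfold Rm. apply RInt_ext. intros y _. unfold minus, plus, opp; simpl.
      rewrite Rmult_0_l, cosh_0. ring. }
    rewrite E. field. lra.
  - replace (Finite (/ (4 * cosh (u / 2)))) with (Rbar_mult (/ cosh (u / 2)) (Rbar_plus (/ 4) 0)).
    + apply (is_lim_seq_scal_l _ (/ cosh (u / 2)) (Rbar_plus (/ 4) 0)).
      apply (is_lim_seq_plus' _ _ (/ 4) 0); [apply sech_partial_0_lim|exact HR].
    + simpl. f_equal. field. lra.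
Qed.

(** * Half-line Fourier integrals from the exponential series *)

Lemma half_int_exp_cos b u :
  0 < b -> half_int (fun t => exp (- (b * t)) * cos (u * t)) (b / (u * u + b * b)).
Proof.
  intros Hb. assert (Hd : 0 < u * u + b * b) by nra.
  set (F := fun t => exp (- (b * t)) * (u * sin (u * t) - b * cos (u * t)) / (u * u + b * b)).
  replace (b / (u * u + b * b)) with (0 - F 0)
    by (unfold F; rewrite !Rmult_0_r, Ropp_0, exp_0, sin_0, cos_0; field; lra).
  apply half_int_derive.
  - intros t. unfold F. auto_derive; [lra|]. field. lra.
  - intros t. apply @ex_derive_continuous. now auto_derive.
  - set (C := (Rabs u + b) / (u * u + b * b)).
    assert (HF : forall t, Rabs (F t) <= C * exp (- (b * t))).
    { intros t. unfold F, C, Rdiv. rewrite !Rabs_mult, Rabs_inv.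
      rewrite (Rabs_pos_eq (exp _)) by (left; apply exp_pos).
      rewrite (Rabs_pos_eq (u * u + b * b)) by lra.
      replace ((Rabs u + b) * / (u * u + b * b) * exp (- (b * t)))
        with (exp (- (b * t)) * (Rabs u + b) * / (u * u + b * b)) by ring.
      apply Rmult_le_compat_r; [left; now apply Rinv_0_lt_compat|].
      apply Rmult_le_compat_l; [left; apply exp_pos|].
      eapply Rle_trans; [apply Rabs_triang|]. rewrite Rabs_Ropp, !Rabs_mult, (Rabs_pos_eq b) by lra.
      assert (Rabs (sin (u * t)) <= 1) by (apply Rabs_le, SIN_bound).
      assert (Rabs (cos (u * t)) <= 1) by (apply Rabs_le, COS_bound).
      generalize (Rabs_pos u). nra. }
    assert (HE : forall c, is_lim (fun t => c * exp (- (b * t))) p_infty 0).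
    { intros c. replace (Finite 0) with (Rbar_mult c 0) by (simpl; f_equal; ring).
      apply is_lim_scal_l, is_lim_exp_decay, Hb. }
    apply (is_lim_le_le_loc (fun t => (- C) * exp (- (b * t))) (fun t => C * exp (- (b * t)))).
    + exists 0. intros t _. generalize (HF t). intros H. apply Rabs_le_between in H. lra.
    + apply HE.
    + apply HE.
Qed.

(** At x = 0 the error has absolute value 1 for every K, so convergence is not uniform; but the
    exponential bound has an integral of order 1 / K. *)
Lemma alternating_exp_error x K :
  0 <= x ->
  Rabs (/ cosh x - 2 * rsum (fun k => (-1) ^ k * exp (- ((2 * INR k + 1) * x))) K)
  <= exp (- (2 * INR K * x)).
Proof.
  intros Hx. rewrite rsum_alternating_exp. assert (Hc := cosh_ge_1 x).
  replace (/ cosh x - 2 * ((1 - (-1) ^ K * exp (- (2 * INR K * x))) / (2 * cosh x)))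
    with ((-1) ^ K * (exp (- (2 * INR K * x)) * / cosh x)) by (field; lra).
  rewrite Rabs_mult, pow_1_abs, Rmult_1_l.
  assert (He := exp_pos (- (2 * INR K * x))).
  assert (Hi : 0 < / cosh x <= 1).
  { split; [apply Rinv_0_lt_compat; lra|]. rewrite <- Rinv_1. apply Rinv_le_contravar; lra. }
  rewrite Rabs_pos_eq by nra. nra.
Qed.

Lemma is_lim_seq_div_INR c a : 0 < a -> is_lim_seq (fun N => c / (a * INR (S N))) 0.
Proof.
  intros Ha. apply (is_lim_seq_ext (fun N => c / a * / INR (S N))).
  - intros N. assert (H := INR_pos (S N) ltac:(lia)). field. lra.
  - replace (Finite 0) with (Rbar_mult (c / a) 0) by (simpl; f_equal; ring).
    apply (is_lim_seq_scal_l _ (c / a) 0).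
    assert (HS : is_lim_seq (fun n => INR (S n)) p_infty)
      by (apply (is_lim_seq_incr_1 INR), is_lim_seq_INR).
    apply (is_lim_seq_inv _ p_infty) in HS; [exact HS|discriminate].
Qed.

Lemma half_int_cos_div_cosh u :
  half_int (fun t => cos (u * t) / cosh (PI * t)) (/ (2 * cosh (u / 2))).
Proof.
  assert (Hpi := PI_RGT_0). assert (Hc := cosh_pos (u / 2)).
  (* Taking S K terms keeps the denominator of the error bound away from 0. *)
  apply (half_int_limit _
    (fun K t => rsum (fun k => (2 * (-1) ^ k) * (exp (- ((2 * INR k + 1) * PI * t)) * cos (u * t))) (S K))
    (fun K => rsum (fun k => (2 * (-1) ^ k) * (((2 * INR k + 1) * PI) /
                 (u * u + ((2 * INR k + 1) * PI) * ((2 * INR k + 1) * PI)))) (S K))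
    (fun K => 1 / ((2 * PI) * INR (S K)))).
  - intros x. apply @ex_derive_continuous. auto_derive. generalize (cosh_pos (PI * x)). lra.
  - intros K. apply half_int_rsum. intros k _.
    apply half_int_scal, half_int_exp_cos, odd_PI_pos.
  - intros K b Hb. assert (HK := INR_pos (S K) ltac:(lia)).
    apply RInt_diff_exp_bound; try lra; try nra.
    + intros x. apply @ex_derive_continuous. auto_derive. generalize (cosh_pos (PI * x)). lra.
    + intros x. apply continuous_rsum. intros k _. apply @ex_derive_continuous. now auto_derive.
    + intros t Ht. rewrite Rmult_1_l.
      rewrite (rsum_ext _ (fun k => (2 * cos (u * t)) * ((-1) ^ k * exp (- ((2 * INR k + 1) * (PI * t))))))
        by (intros k _; rewrite Rmult_assoc, (Rmult_assoc (2 * INR k + 1) PI t); ring).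
      rewrite rsum_scal.
      match goal with |- Rabs (_ - 2 * _ * ?s) <= _ =>
        replace (cos (u * t) / cosh (PI * t) - 2 * cos (u * t) * s)
          with (cos (u * t) * (/ cosh (PI * t) - 2 * s)) by (unfold Rdiv; ring) end.
      rewrite Rabs_mult.
      assert (Hcos : Rabs (cos (u * t)) <= 1) by (apply Rabs_le, COS_bound).
      assert (He := alternating_exp_error (PI * t) (S K) ltac:(nra)).
      replace (2 * PI * INR (S K) * t) with (2 * INR (S K) * (PI * t)) by ring.
      eapply Rle_trans; [|exact He].
      rewrite <- (Rmult_1_l (Rabs (/ cosh (PI * t) - _))) at 2.
      apply Rmult_le_compat_r; [apply Rabs_pos|exact Hcos].
  - apply is_lim_seq_div_INR. lra.
  - apply (is_lim_seq_incr_1 (fun K => rsum (fun k => (2 * (-1) ^ k) * (((2 * INR k + 1) * PI) /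
                 (u * u + ((2 * INR k + 1) * PI) * ((2 * INR k + 1) * PI)))) K)).
    apply (is_lim_seq_ext (fun K => 2 * sech_partial u K)).
    + intros K. unfold sech_partial. rewrite <- rsum_scal. apply rsum_ext. intros k _. ring.
    + replace (Finite (/ (2 * cosh (u / 2)))) with (Rbar_mult 2 (/ (4 * cosh (u / 2))))
        by (simpl; f_equal; field; lra).
      apply (is_lim_seq_scal_l _ 2 (/ (4 * cosh (u / 2)))), sech_partial_lim.
Qed.

(** * Analytic continuation along horizontal lines *)

Definition analytic_at (f : R -> R) (x0 : R) : Prop :=
  exists (a : nat -> R) (r : R), 0 < r /\
    forall d, Rabs d < r -> is_series (fun p => a p * d ^ p) (f (x0 + d)).

Lemma power_series_zero_right_0 (a : nat -> R) r :
  0 < r -> (forall d, 0 < d < r -> is_series (fun p => a p * d ^ p) 0) -> a 0%nat = 0.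
Proof.
  intros Hr H.
  assert (HP : forall d, 0 < d < r -> PSeries a d = 0).
  { intros d Hd. apply is_pseries_unique, is_pseries_R. auto. }
  (* Convergence at the single point r / 2 already makes the radius positive, so the sum is
     continuous at 0 and its value there is its limit from the right. *)
  assert (Hcv : Rbar_lt (Rabs 0) (CV_radius a)).
  { rewrite Rabs_R0. destruct (Rbar_lt_le_dec 0 (CV_radius a)) as [Hl|Hl]; [exact Hl|exfalso].
    apply (CV_disk_outside a (r / 2)).
    - rewrite Rabs_pos_eq by lra. eapply Rbar_le_lt_trans; [exact Hl|]. simpl. lra.
    - apply ex_series_lim_0. exists 0. apply H. lra. }
  assert (Hc := PSeries_continuity a 0 Hcv).
  rewrite <- PSeries_0.
  destruct (Req_dec (PSeries a 0) 0) as [E|E]; [exact E|exfalso].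
  destruct (Hc (Rabs (PSeries a 0))) as [e [He Hd]]; [now apply Rabs_pos_lt|].
  set (d := Rmin (e / 2) (r / 2)).
  assert (Hd0 : 0 < d) by (apply Rmin_pos; lra).
  assert (Hd1 : d <= e / 2) by apply Rmin_l.
  assert (Hd2 : d <= r / 2) by apply Rmin_r.
  specialize (Hd d). simpl in Hd. unfold D_x, no_cond, R_dist, Rdist in Hd.
  rewrite (HP d) in Hd by lra.
  rewrite !Rminus_0_r in Hd. unfold Rminus in Hd. rewrite Rplus_0_l, Rabs_Ropp in Hd.
  assert (Hx : Rabs d < e) by (rewrite Rabs_pos_eq; lra).
  assert (Hy : 0 <> d) by lra.
  specialize (Hd (conj (conj I Hy) Hx)). lra.
Qed.

Lemma power_series_zero_right (a : nat -> R) r :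
  0 < r -> (forall d, 0 < d < r -> is_series (fun p => a p * d ^ p) 0) ->
  forall p, a p = 0.
Proof.
  intros Hr H p. revert a H.
  induction p as [|p IH]; intros a H.
  - now apply (power_series_zero_right_0 a r).
  - apply (IH (fun p => a (S p))). intros d Hd.
    assert (H0 := power_series_zero_right_0 a r Hr H).
    assert (Hs : is_series (fun p => a (S p) * d ^ (S p)) 0).
    { apply (is_series_incr_1 (fun p => a p * d ^ p)). simpl. rewrite H0.
      match goal with |- is_series _ ?x => replace x with 0 end; [now apply H|].
      unfold plus; simpl. ring. }
    apply (is_series_scal_l (/ d)) in Hs. rewrite Rmult_0_r in Hs.
    eapply is_series_ext; [|exact Hs]. intros n.
    change (/ d * (a (S n) * (d * d ^ n)) = a (S n) * d ^ n). field. lra.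
Qed.

(** Equality on the right alone forces equal Taylor coefficients at x0; the common expansion then
    carries it some distance to the left. *)
Lemma analytic_identity_right_nbhd (f g : R -> R) x0 :
  analytic_at f x0 -> analytic_at g x0 ->
  (forall x, x0 < x -> f x = g x) ->
  exists r, 0 < r /\ forall x, x0 - r < x -> f x = g x.
Proof.
  intros [a [r1 [Hr1 Ha]]] [b [r2 [Hr2 Hb]]] H.
  set (r := Rmin r1 r2).
  assert (Hr : 0 < r) by (apply Rmin_pos; lra).
  assert (HL : r <= r1) by apply Rmin_l. assert (HR : r <= r2) by apply Rmin_r.
  assert (E : forall p, a p - b p = 0).
  { apply (power_series_zero_right (fun p => a p - b p) r Hr). intros d Hd.
    assert (H1 : is_series (fun p => a p * d ^ p) (f (x0 + d)))
      by (apply Ha; rewrite Rabs_pos_eq; lra).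
    assert (H2 : is_series (fun p => b p * d ^ p) (g (x0 + d)))
      by (apply Hb; rewrite Rabs_pos_eq; lra).
    rewrite <- H in H2 by lra.
    assert (H3 := is_series_minus _ _ _ _ H1 H2).
    match type of H3 with is_series _ ?x => replace x with 0 in H3 end.
    - eapply is_series_ext; [|exact H3]. intros n.
      change (a n * d ^ n - b n * d ^ n = (a n - b n) * d ^ n). ring.
    - unfold minus, plus, opp; simpl. ring. }
  exists r. split; [exact Hr|]. intros x Hx.
  destruct (Rlt_le_dec x0 x) as [Hlt|Hle]; [now apply H|].
  assert (Hd : Rabs (x - x0) < r) by (rewrite Rabs_left1; lra).
  specialize (Ha (x - x0) ltac:(lra)). specialize (Hb (x - x0) ltac:(lra)).
  replace (x0 + (x - x0)) with x in Ha, Hb by ring.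
  apply is_series_unique in Ha. apply is_series_unique in Hb. rewrite <- Ha, <- Hb.
  apply Series_ext. intros n. specialize (E n). replace (a n) with (b n) by lra. reflexivity.
Qed.

Lemma analytic_identity (f g : R -> R) :
  (forall x0, 0 < x0 -> analytic_at f x0) -> (forall x0, 0 < x0 -> analytic_at g x0) ->
  (forall x, 1 < x -> f x = g x) -> forall x, 0 < x -> f x = g x.
Proof.
  intros Hf Hg H x1 Hx1.
  destruct (Rlt_le_dec 1 x1) as [H1|H1]; [now apply H|].
  (* y measures how far equality reaches to the left of 1. The cap keeps the centre 1 - M at least
     x1 / 2, inside the domain of analyticity, and reaching the cap covers x1. *)
  set (E := fun y => y <= 1 - x1 / 2 /\ forall x, 1 - y < x -> f x = g x).
  assert (HE0 : E 0).
  { split; [lra|]. intros x Hx. apply H. lra. }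
  assert (Hbd : bound E) by (exists (1 - x1 / 2); intros y [Hy _]; exact Hy).
  destruct (completeness E Hbd (ex_intro _ 0 HE0)) as [M [HM1 HM2]].
  assert (HM0 : 0 <= M) by now apply HM1.
  assert (HMle : M <= 1 - x1 / 2) by (apply HM2; intros y [Hy _]; exact Hy).
  assert (HEM : forall x, 1 - M < x -> f x = g x).
  { intros x Hx. destruct (Req_dec (f x) (g x)) as [Eq|Ne]; [exact Eq|exfalso].
    assert (M <= 1 - x); [|lra].
    apply HM2. intros y [_ Hy]. destruct (Rle_lt_dec y (1 - x)) as [Hl|Hl]; [exact Hl|].
    destruct Ne. apply Hy. lra. }
  destruct (Rle_lt_dec (1 - x1 / 2) M) as [Hge|Hlt].
  - apply HEM. lra.
  - exfalso.
    destruct (analytic_identity_right_nbhd f g (1 - M)) as [r [Hr Hx]]; auto.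
    + apply Hf; lra.
    + apply Hg; lra.
    + set (y := Rmin (M + r) (1 - x1 / 2)).
      assert (Hy1 : y <= M + r) by apply Rmin_l.
      assert (Hy2 : y <= 1 - x1 / 2) by apply Rmin_r.
      assert (HyM : M < y) by (apply Rmin_glb_lt; lra).
      assert (y <= M); [|lra]. apply HM1. split; [exact Hy2|].
      intros x Hx'. apply Hx. lra.
Qed.

(** * Series of power series *)

Lemma is_lim_seq_rsum (f : nat -> nat -> R) (l : nat -> R) P :
  (forall p, (p < P)%nat -> is_lim_seq (f p) (l p)) ->
  is_lim_seq (fun N => rsum (fun p => f p N) P) (rsum l P).
Proof.
  induction P as [|P IH]; intros H; simpl; [apply is_lim_seq_const|].
  apply (is_lim_seq_plus' (fun N => rsum (fun p => f p N) P)); auto with arith.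
Qed.

Lemma is_series_rsum (a : nat -> R) (l : R) :
  is_series a l <-> is_lim_seq (rsum a) l.
Proof.
  split; intros H.
  - apply is_lim_seq_incr_1. apply (is_lim_seq_ext (sum_n a)); [|exact H].
    intros n. apply sum_n_rsum.
  - apply is_lim_seq_incr_1 in H. apply (is_lim_seq_ext _ (sum_n a)) in H; [exact H|].
    intros n. symmetry. apply sum_n_rsum.
Qed.

Lemma ex_series_nonneg_bounded (D : nat -> R) K :
  (forall n, 0 <= D n) -> (forall n, rsum D n <= K) -> ex_series D.
Proof.
  intros H0 HK.
  destruct (ex_finite_lim_seq_incr (rsum D) K) as [l Hl].
  - intros n. simpl. generalize (H0 n). lra.
  - exact HK.
  - exists l. now apply is_series_rsum.
Qed.

Lemma is_lim_seq_Rabs_le (a : nat -> R) (l c B : R) :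
  is_lim_seq a l -> (forall n, Rabs (a n - c) <= B) -> Rabs (l - c) <= B.
Proof.
  intros Ha HB. apply (is_lim_seq_le (fun n => Rabs (a n - c)) (fun _ => B) (Rabs (l - c)) B HB).
  - apply (is_lim_seq_abs _ (l - c)). apply is_lim_seq_minus'; [exact Ha|apply is_lim_seq_const].
  - apply is_lim_seq_const.
Qed.

Lemma rsum_le_nat (D : nat -> R) m n :
  (forall k, 0 <= D k) -> (m <= n)%nat -> rsum D m <= rsum D n.
Proof.
  intros H Hmn. induction Hmn as [|n Hmn IH]; [lra|]. simpl. generalize (H n). lra.
Qed.

Lemma power_series_tail_bound (c : nat -> R) rho D d F P :
  0 < rho -> Rabs d < rho ->
  (forall Q, rsum (fun p => Rabs (c p) * rho ^ p) Q <= D) ->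
  is_series (fun p => c p * d ^ p) F ->
  Rabs (F - rsum (fun p => c p * d ^ p) P) <= (Rabs d / rho) ^ P * D.
Proof.
  intros Hr Hd HD HF. set (q := Rabs d / rho).
  assert (Hq : 0 <= q <= 1).
  { unfold q. split; [apply Rdiv_le_0_compat; [apply Rabs_pos|exact Hr]|].
    apply Rmult_le_reg_r with rho; [exact Hr|]. unfold Rdiv.
    rewrite Rmult_assoc, Rinv_l, Rmult_1_r, Rmult_1_l by lra. lra. }
  assert (Hdq : Rabs d = q * rho) by (unfold q; field; lra).
  apply is_series_rsum in HF. apply (is_lim_seq_incr_n _ P) in HF.
  apply (is_lim_seq_Rabs_le _ _ _ _ HF). intros Q.
  assert (Hnn : forall p, 0 <= Rabs (c p) * rho ^ p)
    by (intros p; apply Rmult_le_pos; [apply Rabs_pos|left; now apply pow_lt]).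
  assert (HqP : 0 <= q ^ P) by (apply pow_le; lra).
  apply Rle_trans with (q ^ P * (rsum (fun p => Rabs (c p) * rho ^ p) (Q + P)
                                 - rsum (fun p => Rabs (c p) * rho ^ p) P)).
  - induction Q as [|Q IH].
    + simpl. rewrite !Rminus_diag, Rabs_R0, Rmult_0_r. lra.
    + replace (S Q + P)%nat with (S (Q + P)) by lia. cbn [rsum].
      replace (rsum (fun p => c p * d ^ p) (Q + P) + c (Q + P)%nat * d ^ (Q + P)
                 - rsum (fun p => c p * d ^ p) P)
        with ((rsum (fun p => c p * d ^ p) (Q + P) - rsum (fun p => c p * d ^ p) P)
              + c (Q + P)%nat * d ^ (Q + P)) by ring.
      eapply Rle_trans; [apply Rabs_triang|].
      assert (Hn : Rabs (c (Q + P)%nat * d ^ (Q + P)) <= q ^ P * (Rabs (c (Q + P)%nat) * rho ^ (Q + P))).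
      { rewrite Rabs_mult, <- RPow_abs, Hdq, Rpow_mult_distr, pow_add.
        assert (HQ1 : 0 <= q ^ Q <= 1).
        { split; [apply pow_le; lra|]. rewrite <- (pow1 Q). apply pow_incr; lra. }
        specialize (Hnn (Q + P)%nat).
        replace (Rabs (c (Q + P)%nat) * (q ^ Q * q ^ P * rho ^ (Q + P)))
          with (q ^ Q * (q ^ P * (Rabs (c (Q + P)%nat) * rho ^ (Q + P)))) by ring.
        assert (0 <= q ^ P * (Rabs (c (Q + P)%nat) * rho ^ (Q + P))) by now apply Rmult_le_pos.
        nra. }
      lra.
  - apply Rmult_le_compat_l; [exact HqP|].
    assert (0 <= rsum (fun p => Rabs (c p) * rho ^ p) P)
      by (apply (rsum_le_nat _ 0 P Hnn); lia).
    generalize (HD (Q + P)%nat). lra.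
Qed.

(** A double series theorem in the style of Weierstrass: [D b] majorizes the b-th expansion at
    radius rho, and bounded sums of [D] make the remainder after P powers at most (|d| / rho)^P K,
    uniformly in the number of functions summed. *)
Lemma is_series_of_power_series (c : nat -> nat -> R) (F : nat -> R) (G rho d K : R) (D : nat -> R) :
  0 < rho -> Rabs d < rho ->
  (forall b Q, rsum (fun p => Rabs (c b p) * rho ^ p) Q <= D b) ->
  (forall N, rsum D N <= K) ->
  (forall b, is_series (fun p => c b p * d ^ p) (F b)) ->
  is_series F G ->
  is_series (fun p => Series (fun b => c b p) * d ^ p) G.
Proof.
  intros Hr Hd HD HK HF HG.
  assert (HD0 : forall b, 0 <= D b) by (intros b; apply (HD b 0%nat)).
  assert (HexD := ex_series_nonneg_bounded D K HD0 HK).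
  assert (Hc : forall p, is_series (fun b => c b p) (Series (fun b => c b p))).
  { intros p. apply Series_correct.
    assert (Hrp : 0 < rho ^ p) by now apply pow_lt.
    apply (@ex_series_le R_AbsRing R_CompleteNormedModule _ (fun b => / rho ^ p * D b)).
    - intros b. change (Rabs (c b p) <= / rho ^ p * D b).
      apply Rmult_le_reg_r with (rho ^ p); [exact Hrp|].
      replace (/ rho ^ p * D b * rho ^ p) with (D b) by (field; lra).
      eapply Rle_trans; [|apply (HD b (S p))]. simpl.
      assert (0 <= rsum (fun p => Rabs (c b p) * rho ^ p) p); [|lra].
      apply (rsum_le_nat _ 0 p); [|lia].
      intros k. apply Rmult_le_pos; [apply Rabs_pos|left; now apply pow_lt].
    - now apply (ex_series_scal_l (/ rho ^ p) D). }
  set (C := fun p => Series (fun b => c b p)) in *.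
  set (q := Rabs d / rho).
  assert (Hq : 0 <= q < 1).
  { unfold q. split; [apply Rdiv_le_0_compat; [apply Rabs_pos|exact Hr]|].
    apply Rmult_lt_reg_r with rho; [exact Hr|]. unfold Rdiv.
    rewrite Rmult_assoc, Rinv_l, Rmult_1_r, Rmult_1_l by lra. lra. }
  assert (Hmain : forall P, Rabs (rsum (fun p => C p * d ^ p) P - G) <= q ^ P * K).
  { intros P.
    assert (Hlim : is_lim_seq (fun N => rsum F N - rsum (fun p => rsum (fun b => c b p) N * d ^ p) P)
                              (G - rsum (fun p => C p * d ^ p) P)).
    { apply is_lim_seq_minus'; [now apply is_series_rsum|].
      apply (is_lim_seq_rsum (fun p N => rsum (fun b => c b p) N * d ^ p)). intros p _.
      apply (is_lim_seq_mult' _ _ (C p) (d ^ p)); [apply is_series_rsum, Hc|apply is_lim_seq_const]. }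
    rewrite Rabs_minus_sym. rewrite <- (Rminus_0_r (G - _)).
    apply (is_lim_seq_Rabs_le _ _ 0 _ Hlim). intros N. rewrite Rminus_0_r.
    rewrite (rsum_ext (fun p => rsum (fun b => c b p) N * d ^ p)
               (fun p => rsum (fun b => c b p * d ^ p) N)).
    - rewrite rsum_swap, <- rsum_minus.
      eapply Rle_trans; [apply (rsum_Rabs_le _ (fun b => q ^ P * D b))|].
      + intros b _. apply power_series_tail_bound; auto.
      + rewrite rsum_scal. apply Rmult_le_compat_l; [apply pow_le; lra|apply HK].
    - intros p _. rewrite Rmult_comm, <- rsum_scal. apply rsum_ext. intros b _. ring. }
  apply is_series_rsum.
  assert (Hgeom : is_lim_seq (fun P => q ^ P * K) 0).
  { replace (Finite 0) with (Rbar_mult 0 K) by (simpl; f_equal; ring).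
    apply (is_lim_seq_scal_r _ K 0). apply is_lim_seq_geom. rewrite (Rabs_pos_eq q) by apply Hq. apply Hq. }
  apply (is_lim_seq_le_le (fun P => G - q ^ P * K) _ (fun P => G + q ^ P * K)).
  - intros P. specialize (Hmain P). apply Rabs_le_between in Hmain.
    change (rsum (fun p => Series (fun b => c b p) * d ^ p) P) with (rsum (fun p => C p * d ^ p) P). lra.
  - replace (Finite G) with (Finite (G - 0)) by (f_equal; ring).
    apply is_lim_seq_minus'; [apply is_lim_seq_const|exact Hgeom].
  - replace (Finite G) with (Finite (G + 0)) by (f_equal; ring).
    apply is_lim_seq_plus'; [apply is_lim_seq_const|exact Hgeom].
Qed.

(** * The Dirichlet series of chi4 to the right of 0 *)

(** In the variable u = ln j, with phi (x) = cos (t x) or - sin (t x), exp (- s u) phi (u) is the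
    real or imaginary part of j^(- s - i t). *)
Definition pair_term (phi : R -> R) (s u v : R) : R :=
  exp (- (s * u)) * phi u - exp (- (s * v)) * phi v.

(** Converts a length v - u, which comes from a Lipschitz bound, into a difference of exponentials,
    which telescopes. *)
Lemma exp_diff_ge s u v :
  0 < s -> u <= v -> s * (v - u) * exp (- (s * v)) <= exp (- (s * u)) - exp (- (s * v)).
Proof.
  intros Hs Huv.
  assert (H : 1 + s * (v - u) <= exp (s * (v - u))) by (apply exp_ineq1_le).
  assert (He := exp_pos (- (s * v))).
  replace (exp (- (s * u))) with (exp (- (s * v)) * exp (s * (v - u)))
    by (rewrite <- exp_plus; f_equal; ring).
  nra.
Qed.

(** The common properties of x -> cos (t x) and x -> - sin (t x), with tau = |t|; real and imaginary
    parts are then treated at once. *)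
Definition unit_lipschitz (tau : R) (phi : R -> R) : Prop :=
  0 <= tau /\ (forall x, Rabs (phi x) <= 1) /\
  (forall x y, x <= y -> Rabs (phi x - phi y) <= tau * (y - x)).

Lemma pair_term_bound tau phi s u v :
  unit_lipschitz tau phi -> 0 < s -> u <= v ->
  Rabs (pair_term phi s u v) <= (1 + tau / s) * (exp (- (s * u)) - exp (- (s * v))).
Proof.
  intros [Ht [H1 HL]] Hs Huv. unfold pair_term.
  assert (Hd := exp_diff_ge s u v Hs Huv).
  assert (Hev := exp_pos (- (s * v))).
  assert (Hmon : 0 <= exp (- (s * u)) - exp (- (s * v))) by (assert (0 <= s * (v - u)) by nra; nra).
  replace (exp (- (s * u)) * phi u - exp (- (s * v)) * phi v)
    with ((exp (- (s * u)) - exp (- (s * v))) * phi u + exp (- (s * v)) * (phi u - phi v)) by ring.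
  eapply Rle_trans; [apply Rabs_triang|]. rewrite !Rabs_mult.
  rewrite (Rabs_pos_eq (exp (- (s * v)))), (Rabs_pos_eq (_ - _)) by lra.
  specialize (H1 u). specialize (HL u v Huv).
  assert (Hts : 0 <= tau / s) by (apply Rdiv_le_0_compat; lra).
  assert (E2 : exp (- (s * v)) * (tau * (v - u))
               <= tau / s * (exp (- (s * u)) - exp (- (s * v)))).
  { replace (exp (- (s * v)) * (tau * (v - u)))
      with (tau / s * (s * (v - u) * exp (- (s * v)))) by (field; lra).
    now apply Rmult_le_compat_l. }
  assert (exp (- (s * v)) * Rabs (phi u - phi v) <= exp (- (s * v)) * (tau * (v - u)))
    by (apply Rmult_le_compat_l; lra).
  nra.
Qed.

Definition pair_coef (phi : R -> R) (s u v : R) (p : nat) : R :=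
  (exp (- (s * u)) * phi u * (- u) ^ p - exp (- (s * v)) * phi v * (- v) ^ p) * / INR (fact p).

(** Obtained by writing the numerator of the p-th Taylor coefficient, up to sign, as the pair term
    times u^p minus exp (- s v) phi (v) (v^p - u^p), then summing absolute values against rho^p /
    p!. *)
Definition pair_majorant (phi : R -> R) (s rho u v : R) : R :=
  Rabs (pair_term phi s u v) * exp (rho * u) + exp (- (s * v)) * (exp (rho * v) - exp (rho * u)).

Lemma is_series_exp x : is_series (fun p => x ^ p * / INR (fact p)) (exp x).
Proof.
  apply (is_series_ext (fun p => / INR (fact p) * x ^ p)); [intros n; apply Rmult_comm|].
  apply is_pseries_R, is_exp_Reals.
Qed.

Lemma is_series_scal_exp c x :
  is_series (fun p => c * (x ^ p * / INR (fact p))) (c * exp x).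
Proof. exact (is_series_scal_l c (fun p => x ^ p * / INR (fact p)) _ (is_series_exp x)). Qed.

Lemma rsum_le_series (a : nat -> R) (l : R) n :
  (forall k, 0 <= a k) -> is_series a l -> rsum a n <= l.
Proof.
  intros H0 H. apply is_series_rsum in H. apply (is_lim_seq_incr_n _ n) in H.
  apply (is_lim_seq_le (fun _ => rsum a n) (fun k => rsum a (k + n)) (rsum a n) l).
  - intros k. apply rsum_le_nat; [exact H0|lia].
  - apply is_lim_seq_const.
  - exact H.
Qed.

Lemma pair_coef_sum_le phi s rho u v Q :
  (forall x, Rabs (phi x) <= 1) -> 0 < rho -> 0 <= u <= v ->
  rsum (fun p => Rabs (pair_coef phi s u v p) * rho ^ p) Q <= pair_majorant phi s rho u v.
Proof.
  intros H1 Hr Huv.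
  set (A := Rabs (pair_term phi s u v)). set (E := exp (- (s * v))).
  set (a := fun p => A * ((rho * u) ^ p * / INR (fact p))
                     + E * ((rho * v) ^ p * / INR (fact p) - (rho * u) ^ p * / INR (fact p))).
  assert (HE : 0 < E) by apply exp_pos. assert (HA : 0 <= A) by apply Rabs_pos.
  assert (Hf : forall p, 0 < / INR (fact p)) by (intros p; apply Rinv_0_lt_compat, INR_fact_lt_0).
  assert (Hmono : forall p, 0 <= u ^ p <= v ^ p)
    by (intros p; split; [apply pow_le; lra|apply pow_incr; lra]).
  apply Rle_trans with (rsum a Q).
  - apply rsum_le. intros p _. unfold a, pair_coef.
    rewrite Rabs_mult, (Rabs_pos_eq (/ _)) by (left; apply Hf).
    rewrite !Rpow_mult_distr.
    replace (A * (rho ^ p * u ^ p * / INR (fact p)) +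
       E * (rho ^ p * v ^ p * / INR (fact p) - rho ^ p * u ^ p * / INR (fact p)))
      with ((A * u ^ p + E * (v ^ p - u ^ p)) * (/ INR (fact p) * rho ^ p)) by ring.
    rewrite Rmult_assoc. apply Rmult_le_compat_r.
    { apply Rmult_le_pos; [left; apply Hf|left; now apply pow_lt]. }
    replace (- u) with (-1 * u) by ring. replace (- v) with (-1 * v) by ring.
    rewrite !Rpow_mult_distr.
    replace (exp (- (s * u)) * phi u * ((-1) ^ p * u ^ p) - exp (- (s * v)) * phi v * ((-1) ^ p * v ^ p))
      with ((-1) ^ p * (pair_term phi s u v * u ^ p + - (E * phi v * (v ^ p - u ^ p))))
      by (unfold pair_term, E; ring).
    rewrite Rabs_mult, pow_1_abs, Rmult_1_l.
    eapply Rle_trans; [apply Rabs_triang|]. rewrite Rabs_Ropp, !Rabs_mult. fold A.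
    specialize (Hmono p). specialize (H1 v).
    rewrite (Rabs_pos_eq (u ^ p)), (Rabs_pos_eq E), (Rabs_pos_eq (v ^ p - u ^ p)) by lra.
    apply Rplus_le_compat_l. apply Rmult_le_compat_r; [lra|].
    rewrite <- (Rmult_1_r E) at 2. apply Rmult_le_compat_l; lra.
  - apply rsum_le_series.
    + intros p. unfold a. rewrite !Rpow_mult_distr. specialize (Hmono p).
      assert (0 < rho ^ p * / INR (fact p)) by (apply Rmult_lt_0_compat; [now apply pow_lt|apply Hf]).
      replace (A * (rho ^ p * u ^ p * / INR (fact p)) +
         E * (rho ^ p * v ^ p * / INR (fact p) - rho ^ p * u ^ p * / INR (fact p)))
        with ((A * u ^ p + E * (v ^ p - u ^ p)) * (rho ^ p * / INR (fact p))) by ring.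
      apply Rmult_le_pos; [|lra].
      assert (0 <= A * u ^ p) by (apply Rmult_le_pos; lra).
      assert (0 <= E * (v ^ p - u ^ p)) by (apply Rmult_le_pos; lra). lra.
    + unfold a, pair_majorant. fold A E.
      apply (is_series_plus (fun p => A * ((rho * u) ^ p * / INR (fact p)))
               (fun p => E * ((rho * v) ^ p * / INR (fact p) - (rho * u) ^ p * / INR (fact p)))).
      * apply is_series_scal_exp.
      * apply (is_series_scal_l E (fun p => (rho * v) ^ p * / INR (fact p) - (rho * u) ^ p * / INR (fact p))).
        apply (is_series_minus (fun p => (rho * v) ^ p * / INR (fact p))
                 (fun p => (rho * u) ^ p * / INR (fact p)));
          apply is_series_exp.
Qed.

(** Both parts of the majorant reduce to a difference of exponentials with the positive rate eta = s
    - rho, so summing over interlaced pairs stays bounded. *)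
Lemma pair_majorant_le tau phi s rho u v (eta := s - rho) :
  unit_lipschitz tau phi -> 0 < rho < s -> u <= v ->
  pair_majorant phi s rho u v <=
  ((1 + tau / s) * (1 + rho / eta) + rho / eta) * (exp (- (eta * u)) - exp (- (eta * v))).
Proof.
  intros HL Hr Huv. assert (Heta : 0 < eta) by (unfold eta; lra).
  unfold pair_majorant. set (Delta := exp (- (eta * u)) - exp (- (eta * v))).
  assert (Hp := pair_term_bound tau phi s u v HL ltac:(lra) Huv).
  assert (H2 : exp (- (s * v)) * (exp (rho * v) - exp (rho * u)) <= rho / eta * Delta).
  { assert (H := exp_diff_ge eta u v Heta Huv).
    assert (Hq : 1 + rho * (u - v) <= exp (rho * (u - v))) by apply exp_ineq1_le.
    assert (He := exp_pos (- (eta * v))).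
    replace (exp (- (s * v)) * (exp (rho * v) - exp (rho * u)))
      with (exp (- (eta * v)) * (1 - exp (rho * (u - v)))).
    - apply Rle_trans with (exp (- (eta * v)) * (rho * (v - u))).
      + apply Rmult_le_compat_l; lra.
      + replace (exp (- (eta * v)) * (rho * (v - u)))
          with (rho / eta * (eta * (v - u) * exp (- (eta * v)))) by (field; lra).
        apply Rmult_le_compat_l; [apply Rdiv_le_0_compat; lra|exact H].
    - rewrite !Rmult_minus_distr_l, Rmult_1_r, <- !exp_plus. unfold eta. f_equal; f_equal; ring. }
  assert (Hts : 0 <= tau / s) by (destruct HL; apply Rdiv_le_0_compat; lra).
  assert (He := exp_pos (rho * u)).
  assert (H3 : (exp (- (s * u)) - exp (- (s * v))) * exp (rho * u)
               = Delta + exp (- (s * v)) * (exp (rho * v) - exp (rho * u))).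
  { unfold Delta. rewrite Rmult_minus_distr_r, Rmult_minus_distr_l, <- !exp_plus.
    replace (- (s * u) + rho * u) with (- (eta * u)) by (unfold eta; ring).
    replace (- (s * v) + rho * v) with (- (eta * v)) by (unfold eta; ring). ring. }
  apply Rmult_le_compat_r with (r := exp (rho * u)) in Hp; [|lra].
  rewrite Rmult_assoc, H3 in Hp.
  assert ((1 + tau / s) * (Delta + exp (- (s * v)) * (exp (rho * v) - exp (rho * u)))
          <= (1 + tau / s) * (Delta + rho / eta * Delta)) by (apply Rmult_le_compat_l; lra).
  lra.
Qed.

Lemma is_series_pair_coef phi s u v d :
  is_series (fun p => pair_coef phi s u v p * d ^ p) (pair_term phi (s + d) u v).
Proof.
  set (a := exp (- (s * u)) * phi u). set (b := exp (- (s * v)) * phi v).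
  apply (is_series_ext (fun p => a * ((- u * d) ^ p * / INR (fact p))
                                 - b * ((- v * d) ^ p * / INR (fact p)))).
  - intros p. unfold pair_coef. fold a b. rewrite !Rpow_mult_distr.
    match goal with |- ?x = ?y => change (@eq R x y) end. ring.
  - replace (pair_term phi (s + d) u v) with (a * exp (- u * d) - b * exp (- v * d)).
    + apply (is_series_minus (fun p => a * ((- u * d) ^ p * / INR (fact p)))
               (fun p => b * ((- v * d) ^ p * / INR (fact p)))).
      * apply is_series_scal_exp.
      * apply is_series_scal_exp.
    + unfold pair_term, a, b.
      replace (- ((s + d) * u)) with (- (s * u) + - u * d) by ring.
      replace (- ((s + d) * v)) with (- (s * v) + - v * d) by ring.
      rewrite !exp_plus. ring.
Qed.

(** The intervals [u b, v b] do not overlap, so for a decreasing function the drops across them add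
    up to at most its total drop. *)
Definition interlaced (u v : nat -> R) : Prop :=
  0 <= u 0%nat /\ forall b, u b <= v b <= u (S b).

Lemma interlaced_pos u v b : interlaced u v -> 0 <= u b.
Proof.
  intros [H0 H]. induction b as [|b IH]; [exact H0|]. destruct (H b). lra.
Qed.

Lemma interlaced_sum_le u v eta M N :
  interlaced u v -> 0 < eta ->
  rsum (fun b => exp (- (eta * u (M + b)%nat)) - exp (- (eta * v (M + b)%nat))) N
  <= exp (- (eta * u M)).
Proof.
  intros [H0 H] He.
  apply Rle_trans with (rsum (fun b => exp (- (eta * u (M + b)%nat)) - exp (- (eta * u (M + S b)%nat))) N).
  - apply rsum_le. intros b _. apply Rplus_le_compat_l, Ropp_le_contravar, exp_le.
    rewrite Nat.add_succ_r. destruct (H (M + b)%nat). nra.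
  - rewrite (rsum_telescope (fun b => exp (- (eta * u (M + b)%nat)))), Nat.add_0_r.
    generalize (exp_pos (- (eta * u (M + N)%nat))). lra.
Qed.

Lemma ex_series_pair tau phi u v s :
  unit_lipschitz tau phi -> interlaced u v -> 0 < s ->
  ex_series (fun b => pair_term phi s (u b) (v b)).
Proof.
  intros HL Hi Hs.
  apply (@ex_series_le R_AbsRing R_CompleteNormedModule _
    (fun b => (1 + tau / s) * (exp (- (s * u b)) - exp (- (s * v b))))).
  - intros b. apply (pair_term_bound tau phi s (u b) (v b)); auto. apply Hi.
  - apply (ex_series_scal_l (1 + tau / s) (fun b => exp (- (s * u b)) - exp (- (s * v b)))).
    apply (ex_series_nonneg_bounded _ (exp (- (s * u 0%nat)))).
    + intros b. assert (Hb : u b <= v b) by apply Hi.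
      assert (exp (- (s * v b)) <= exp (- (s * u b))) by (apply exp_le; nra). lra.
    + intros N. apply (interlaced_sum_le u v s 0 N Hi Hs).
Qed.

Lemma pair_series_analytic tau phi u v (G : R -> R) :
  unit_lipschitz tau phi -> interlaced u v ->
  (forall s, 0 < s -> is_series (fun b => pair_term phi s (u b) (v b)) (G s)) ->
  forall s, 0 < s -> analytic_at G s.
Proof.
  intros HL Hi HG s Hs.
  (* With radius s / 2 the rate eta is s / 2 > 0, and s + d stays in the half-line where the series
     is known to converge. *)
  exists (fun p => Series (fun b => pair_coef phi s (u b) (v b) p)), (s / 2).
  split; [lra|]. intros d Hd.
  set (eta := s - s / 2). assert (Heta : 0 < eta) by (unfold eta; lra).
  set (K := (1 + tau / s) * (1 + s / 2 / eta) + s / 2 / eta).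
  assert (HK : 0 <= K).
  { assert (0 <= tau / s) by (destruct HL; apply Rdiv_le_0_compat; lra).
    assert (0 <= s / 2 / eta) by (apply Rdiv_le_0_compat; lra). unfold K. nra. }
  apply (is_series_of_power_series (fun b p => pair_coef phi s (u b) (v b) p)
           (fun b => pair_term phi (s + d) (u b) (v b)) _ (s / 2) d
           (K * exp (- (eta * u 0%nat))) (fun b => pair_majorant phi s (s / 2) (u b) (v b))).
  - lra.
  - exact Hd.
  - intros b Q. apply pair_coef_sum_le; [apply HL|lra|].
    split; [now apply (interlaced_pos u v)|apply Hi].
  - intros N.
    apply Rle_trans with
      (K * rsum (fun b => exp (- (eta * u (0 + b)%nat)) - exp (- (eta * v (0 + b)%nat))) N).
    + rewrite <- rsum_scal. apply rsum_le. intros b _.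
      apply (pair_majorant_le tau phi s (s / 2) (u b) (v b)); [exact HL|lra|apply Hi].
    + apply Rmult_le_compat_l; [exact HK|]. now apply interlaced_sum_le.
  - intros b. apply is_series_pair_coef.
  - apply HG. apply Rabs_def2 in Hd. lra.
Qed.

Lemma pair_sum_bound tau phi u v s M N :
  unit_lipschitz tau phi -> interlaced u v -> 0 < s ->
  Rabs (rsum (fun b => pair_term phi s (u (M + b)%nat) (v (M + b)%nat)) N)
  <= (1 + tau / s) * exp (- (s * u M)).
Proof.
  intros HL Hi Hs.
  eapply Rle_trans; [apply (rsum_Rabs_le _ (fun b => (1 + tau / s) *
    (exp (- (s * u (M + b)%nat)) - exp (- (s * v (M + b)%nat)))))|].
  - intros b _. apply pair_term_bound; auto. apply Hi.
  - rewrite rsum_scal. apply Rmult_le_compat_l.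
    + assert (0 <= tau / s) by (destruct HL; apply Rdiv_le_0_compat; lra). lra.
    + now apply interlaced_sum_le.
Qed.

Lemma rsum_split f M N : rsum f (M + N) = rsum f M + rsum (fun k => f (M + k)%nat) N.
Proof.
  induction N as [|N IH]; simpl.
  - rewrite Nat.add_0_r. ring.
  - rewrite Nat.add_succ_r. simpl. rewrite IH. ring.
Qed.

Lemma pair_series_error tau phi u v s (G : R) M :
  unit_lipschitz tau phi -> interlaced u v -> 0 < s ->
  is_series (fun b => pair_term phi s (u b) (v b)) G ->
  Rabs (G - rsum (fun b => pair_term phi s (u b) (v b)) M) <= (1 + tau / s) * exp (- (s * u M)).
Proof.
  intros HL Hi Hs HG. apply is_series_rsum in HG. apply (is_lim_seq_incr_n _ M) in HG.
  apply (is_lim_seq_Rabs_le _ _ _ _ HG). intros N.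
  rewrite Nat.add_comm, rsum_split. unfold Rminus. rewrite Rplus_comm, <- Rplus_assoc, Rplus_opp_l, Rplus_0_l.
  now apply pair_sum_bound.
Qed.

(** * Real and imaginary parts on a horizontal line *)

Lemma sum_n_C_fst_snd (a : nat -> C) n :
  sum_n (G := C_AbelianMonoid) a n
  = (rsum (fun k => fst (a k)) (S n), rsum (fun k => snd (a k)) (S n)).
Proof.
  induction n as [|n IH].
  - rewrite sum_O. simpl. rewrite !Rplus_0_l. now destruct (a 0%nat).
  - rewrite sum_Sn, IH. destruct (a (S n)) as [x y] eqn:E. cbn [rsum]. rewrite E. reflexivity.
Qed.

Lemma is_series_C_fst_snd (a : nat -> C) (l : C) :
  is_series (K := C_AbsRing) (V := C_NormedModule) a l ->
  is_series (fun n => fst (a n)) (fst l) /\ is_series (fun n => snd (a n)) (snd l).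
Proof.
  intros H. rewrite !is_series_rsum.
  assert (Hb : forall eps : posreal, exists N, forall n, (N <= n)%nat ->
     Rabs (rsum (fun k => fst (a k)) (S n) - fst l) < eps /\
     Rabs (rsum (fun k => snd (a k)) (S n) - snd l) < eps).
  { intros eps. destruct (proj1 (filterlim_locally _ _) H eps) as [N HN].
    exists N. intros n Hn. specialize (HN n Hn).
    change (ball (M := prod_UniformSpace R_UniformSpace R_UniformSpace) l eps
              (sum_n (G := C_AbelianMonoid) a n)) in HN.
    rewrite sum_n_C_fst_snd in HN. exact HN. }
  split; apply is_lim_seq_incr_1, is_lim_seq_spec; intros eps;
    destruct (Hb eps) as [N HN]; exists N; intros n Hn; apply HN, Hn.
Qed.

Lemma pow_n_C_real (d : R) p : pow_n (K := C_AbsRing) (RtoC d) p = RtoC (d ^ p).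
Proof.
  induction p as [|p IH]; [reflexivity|].
  change (Cmult (RtoC d) (pow_n (K := C_AbsRing) (RtoC d) p) = RtoC (d * d ^ p)).
  rewrite IH. now rewrite RtoC_mult.
Qed.

(** Along a horizontal line the increment is real, so its powers are real and the complex expansion
    splits into two real power series. *)
Lemma analytic_on_C_line (L : C -> C) (t : R) :
  analytic_on_C L -> forall s,
  analytic_at (fun x => fst (L (x, t))) s /\ analytic_at (fun x => snd (L (x, t))) s.
Proof.
  intros HL s. destruct (HL (s, t)) as [a [r [Hr H]]].
  assert (HS : forall d, Rabs d < r ->
    is_series (fun p => fst (a p) * d ^ p) (fst (L (s + d, t))) /\
    is_series (fun p => snd (a p) * d ^ p) (snd (L (s + d, t)))).
  { intros d Hd. specialize (H (s + d, t)).
    replace (Cminus (s + d, t) (s, t)) with (RtoC d) in H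
      by (unfold RtoC, Cminus, Cplus, Copp; simpl; f_equal; ring).
    rewrite Cmod_R in H. specialize (H Hd). apply is_series_C_fst_snd in H.
    destruct H as [H1 H2].
    split; [eapply is_series_ext; [|exact H1]|eapply is_series_ext; [|exact H2]]; intros p.
    - change (fst (Cmult (pow_n (K := C_AbsRing) (RtoC d) p) (a p)) = fst (a p) * d ^ p).
      rewrite pow_n_C_real. simpl. ring.
    - change (snd (Cmult (pow_n (K := C_AbsRing) (RtoC d) p) (a p)) = snd (a p) * d ^ p).
      rewrite pow_n_C_real. simpl. ring. }
  split; [exists (fun p => fst (a p)), r|exists (fun p => snd (a p)), r];
    (split; [exact Hr|]; intros d Hd; apply HS, Hd).
Qed.

Lemma rsum_mult4 f N :
  rsum f (4 * N) =
  rsum (fun b => f (4 * b)%nat + f (4 * b + 1)%nat + f (4 * b + 2)%nat + f (4 * b + 3)%nat) N.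
Proof.
  induction N as [|N IH]; [reflexivity|].
  replace (4 * S N)%nat with (S (S (S (S (4 * N))))) by lia. cbn [rsum]. rewrite IH.
  rewrite !Nat.add_succ_r, Nat.add_0_r. ring.
Qed.

(** * The Dirichlet series regrouped in pairs *)

Definition ln_odd (a : nat) : R := ln (INR (2 * a + 1)).

Lemma ln_odd_0 : ln_odd 0 = 0.
Proof. unfold ln_odd. simpl. apply ln_1. Qed.

Lemma ln_odd_le a b : (a <= b)%nat -> ln_odd a <= ln_odd b.
Proof.
  intros H. unfold ln_odd. apply Rcomplements.ln_le; [apply INR_pos; lia|apply le_INR; lia].
Qed.

(** [ln_u] and [ln_v] are the logarithms of 4 b + 1 and 4 b + 3, where chi4 takes the values 1 and
    -1. *)
Definition ln_u (b : nat) : R := ln_odd (2 * b).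
Definition ln_v (b : nat) : R := ln_odd (2 * b + 1).

Lemma interlaced_ln : interlaced ln_u ln_v.
Proof.
  split; [unfold ln_u; simpl; rewrite ln_odd_0; lra|].
  intros b. unfold ln_u, ln_v. split; apply ln_odd_le; lia.
Qed.

Lemma chi4_mod4 b r : chi4 (Z.of_nat (4 * b + r)) = chi4 (Z.of_nat r).
Proof.
  unfold chi4. replace (Z.of_nat (4 * b + r)) with (Z.of_nat r + Z.of_nat b * 4)%Z by lia.
  now rewrite Z_mod_plus_full.
Qed.

Lemma Cpow_pos_fst a s t :
  fst (Cpow_pos a (Copp (s, t))) = exp (- (s * ln a)) * cos (t * ln a).
Proof.
  unfold Cpow_pos, Cexp, Cmult, Copp, RtoC; simpl.
  replace (- s * ln a - - t * 0) with (- (s * ln a)) by ring.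
  replace (- s * 0 + - t * ln a) with (- (t * ln a)) by ring.
  now rewrite cos_neg.
Qed.

Lemma Cpow_pos_snd a s t :
  snd (Cpow_pos a (Copp (s, t))) = exp (- (s * ln a)) * - sin (t * ln a).
Proof.
  unfold Cpow_pos, Cexp, Cmult, Copp, RtoC; simpl.
  replace (- s * ln a - - t * 0) with (- (s * ln a)) by ring.
  replace (- s * 0 + - t * ln a) with (- (t * ln a)) by ring.
  now rewrite sin_neg.
Qed.

Lemma chi4_group4 (g : nat -> R) b :
  IZR (chi4 (Z.of_nat (S (4 * b)))) * g (S (4 * b)) +
  IZR (chi4 (Z.of_nat (S (4 * b + 1)))) * g (S (4 * b + 1)) +
  IZR (chi4 (Z.of_nat (S (4 * b + 2)))) * g (S (4 * b + 2)) +
  IZR (chi4 (Z.of_nat (S (4 * b + 3)))) * g (S (4 * b + 3)) =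
  g (2 * (2 * b) + 1)%nat - g (2 * (2 * b + 1) + 1)%nat.
Proof.
  replace (S (4 * b)) with (4 * b + 1)%nat by lia.
  replace (S (4 * b + 1)) with (4 * b + 2)%nat by lia.
  replace (S (4 * b + 2)) with (4 * b + 3)%nat by lia.
  replace (S (4 * b + 3)) with (4 * b + 4)%nat by lia.
  replace (2 * (2 * b) + 1)%nat with (4 * b + 1)%nat by lia.
  replace (2 * (2 * b + 1) + 1)%nat with (4 * b + 3)%nat by lia.
  rewrite !chi4_mod4.
  change (chi4 (Z.of_nat 1)) with 1%Z. change (chi4 (Z.of_nat 2)) with 0%Z.
  change (chi4 (Z.of_nat 3)) with (-1)%Z. change (chi4 (Z.of_nat 4)) with 0%Z. ring.
Qed.

Lemma unit_lipschitz_derive tau phi dphi :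
  0 <= tau -> (forall x, Rabs (phi x) <= 1) ->
  (forall x, is_derive phi x (dphi x)) -> (forall x, Rabs (dphi x) <= tau) ->
  unit_lipschitz tau phi.
Proof.
  intros Ht H1 Hd Hb. split; [exact Ht|split; [exact H1|]]. intros x y Hxy.
  destruct (MVT_gen phi x y dphi) as [c [_ E]].
  - intros z _. apply Hd.
  - intros z _. apply continuity_pt_filterlim, (ex_derive_continuous phi). eexists. apply Hd.
  - rewrite Rabs_minus_sym, E, Rabs_mult, (Rabs_pos_eq (y - x)) by lra.
    apply Rmult_le_compat_r; [lra|apply Hb].
Qed.

Lemma unit_lipschitz_cos t : unit_lipschitz (Rabs t) (fun x => cos (t * x)).
Proof.
  apply (unit_lipschitz_derive _ _ (fun x => t * - sin (t * x))).
  - apply Rabs_pos.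
  - intros x. apply Rabs_le, COS_bound.
  - intros x. auto_derive; trivial. ring.
  - intros x. rewrite Rabs_mult, Rabs_Ropp.
    assert (Rabs (sin (t * x)) <= 1) by (apply Rabs_le, SIN_bound).
    generalize (Rabs_pos t). nra.
Qed.

Lemma unit_lipschitz_opp_sin t : unit_lipschitz (Rabs t) (fun x => - sin (t * x)).
Proof.
  apply (unit_lipschitz_derive _ _ (fun x => t * - cos (t * x))).
  - apply Rabs_pos.
  - intros x. rewrite Rabs_Ropp. apply Rabs_le, SIN_bound.
  - intros x. auto_derive; trivial. ring.
  - intros x. rewrite Rabs_mult, Rabs_Ropp.
    assert (Rabs (cos (t * x)) <= 1) by (apply Rabs_le, COS_bound).
    generalize (Rabs_pos t). nra.
Qed.

(** For s > 1 the pair series is a regrouping of the Dirichlet series; both sides are analytic for s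
    > 0, so the equality persists there. *)
Lemma pair_series_continuation tau phi (f : R -> R) :
  unit_lipschitz tau phi -> (forall s, 0 < s -> analytic_at f s) ->
  (forall s, 1 < s -> is_series (fun j => IZR (chi4 (Z.of_nat (S j))) *
     (exp (- (s * ln (INR (S j)))) * phi (ln (INR (S j))))) (f s)) ->
  forall s, 0 < s -> is_series (fun b => pair_term phi s (ln_u b) (ln_v b)) (f s).
Proof.
  intros HL Hf H.
  set (G := fun s => Series (fun b => pair_term phi s (ln_u b) (ln_v b))).
  assert (HG : forall s, 0 < s -> is_series (fun b => pair_term phi s (ln_u b) (ln_v b)) (G s)).
  { intros s Hs. apply Series_correct. apply (ex_series_pair tau); auto. apply interlaced_ln. }
  assert (HE : forall s, 0 < s -> f s = G s).
  { apply analytic_identity; [exact Hf| |].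
    - apply (pair_series_analytic tau phi ln_u ln_v); auto. apply interlaced_ln.
    - intros s Hs. symmetry. unfold G. apply is_series_unique, is_series_rsum.
      assert (Hl := proj1 (is_series_rsum _ _) (H s Hs)).
      (* One pair uses one period of chi4, so the partial sums of the pair series are the partial
         sums of the full series at multiples of 4. *)
      apply (is_lim_seq_subseq _ _ (fun N => 4 * N)%nat) in Hl.
      + eapply is_lim_seq_ext; [|exact Hl]. intros N.
        cbv beta. rewrite rsum_mult4. apply rsum_ext. intros b _.
        rewrite (chi4_group4 (fun j => exp (- (s * ln (INR j))) * phi (ln (INR j)))).
        reflexivity.
      + apply eventually_subseq. intros N. lia. }
  intros s Hs. rewrite HE by exact Hs. now apply HG.
Qed.

Lemma L_chi4_pair_series (L : C -> C) t s :
  is_L_chi4 L -> 0 < s ->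
  is_series (fun b => pair_term (fun x => cos (t * x)) s (ln_u b) (ln_v b)) (fst (L (s, t))) /\
  is_series (fun b => pair_term (fun x => - sin (t * x)) s (ln_u b) (ln_v b)) (snd (L (s, t))).
Proof.
  intros [Ha HS] Hs.
  assert (HS' : forall s, 1 < s -> _) by (intros x Hx; exact (is_series_C_fst_snd _ _ (HS (x, t) Hx))).
  split.
  - apply (pair_series_continuation (Rabs t) _ (fun x => fst (L (x, t)))); auto.
    + apply unit_lipschitz_cos.
    + intros x _. now apply analytic_on_C_line.
    + intros x Hx. eapply is_series_ext; [|exact (proj1 (HS' x Hx))].
      intros j. cbv beta. rewrite <- Cpow_pos_fst. unfold Cmult. cbn [fst snd RtoC].
      match goal with |- ?x = ?y => change (@eq R x y) end. ring.
  - apply (pair_series_continuation (Rabs t) _ (fun x => snd (L (x, t)))); auto.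
    + apply unit_lipschitz_opp_sin.
    + intros x _. now apply analytic_on_C_line.
    + intros x Hx. eapply is_series_ext; [|exact (proj2 (HS' x Hx))].
      intros j. cbv beta. rewrite <- Cpow_pos_snd. unfold Cmult. cbn [fst snd RtoC].
      match goal with |- ?x = ?y => change (@eq R x y) end. ring.
Qed.

(** * The mean value as a limit of double sums *)

Definition pair_sum_re (B : nat) (t : R) : R :=
  rsum (fun b => pair_term (fun x => cos (t * x)) (1 / 2) (ln_u b) (ln_v b)) B.
Definition pair_sum_im (B : nat) (t : R) : R :=
  rsum (fun b => pair_term (fun x => - sin (t * x)) (1 / 2) (ln_u b) (ln_v b)) B.

(** The constant 1 + tau / s of the pair estimates at tau = |t| and s = 1/2. *)
Definition growth (t : R) : R := 1 + Rabs t / (1 / 2).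
(** Equal to (4 B + 1)^(-1/2), the size of the first omitted term. *)
Definition error (B : nat) : R := exp (- (1 / 2 * ln_u B)).

Lemma error_bounds B : 0 < error B <= 1.
Proof.
  unfold error. split; [apply exp_pos|]. assert (H := interlaced_pos ln_u ln_v B interlaced_ln).
  apply Rle_trans with (exp 0); [apply exp_le; lra|rewrite exp_0; lra].
Qed.

Lemma error_lim : is_lim_seq error 0.
Proof.
  apply (is_lim_seq_ext (fun B => / sqrt (INR (2 * (2 * B) + 1)))).
  - intros B. unfold error, ln_u, ln_odd.
    assert (HB : 0 < INR (2 * (2 * B) + 1)) by (apply INR_pos; lia).
    rewrite exp_Ropp. f_equal. rewrite <- Rpower_sqrt by exact HB. unfold Rpower.
    f_equal. field.
  - replace (Finite 0) with (Rbar_inv p_infty) by reflexivity.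
    apply is_lim_seq_inv; [|discriminate].
    apply (filterlim_comp _ _ _ _ sqrt _ (Rbar_locally p_infty)).
    + apply (is_lim_seq_subseq INR p_infty (fun B => 2 * (2 * B) + 1)%nat).
      * apply eventually_subseq. intros n. lia.
      * apply is_lim_seq_INR.
    + apply filterlim_sqrt_p.
Qed.

Lemma L_chi4_pair_sum_error (L : C -> C) B t :
  is_L_chi4 L ->
  Rabs (fst (L (1 / 2, t)) - pair_sum_re B t) <= growth t * error B /\
  Rabs (snd (L (1 / 2, t)) - pair_sum_im B t) <= growth t * error B.
Proof.
  intros HL. destruct (L_chi4_pair_series L t (1 / 2) HL ltac:(lra)) as [H1 H2].
  split.
  - apply (pair_series_error (Rabs t) (fun x => cos (t * x)) ln_u ln_v (1 / 2)); auto; try lra.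
    + apply unit_lipschitz_cos.
    + apply interlaced_ln.
  - apply (pair_series_error (Rabs t) (fun x => - sin (t * x)) ln_u ln_v (1 / 2)); auto; try lra.
    + apply unit_lipschitz_opp_sin.
    + apply interlaced_ln.
Qed.

(** Read off the real coefficients of the pair series, cos being even and sin odd, instead of
    invoking the reflection principle. *)
Lemma L_chi4_conj (L : C -> C) t :
  is_L_chi4 L ->
  fst (L (1 / 2, - t)) = fst (L (1 / 2, t)) /\ snd (L (1 / 2, - t)) = - snd (L (1 / 2, t)).
Proof.
  intros HL. destruct (L_chi4_pair_series L t (1 / 2) HL ltac:(lra)) as [H1 H2].
  destruct (L_chi4_pair_series L (- t) (1 / 2) HL ltac:(lra)) as [H3 H4].
  apply is_series_rsum in H1, H2, H3, H4. split.
  - apply is_lim_seq_unique in H1, H3. apply Rbar_finite_eq. rewrite <- H1, <- H3.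
    apply Lim_seq_ext. intros N. apply rsum_ext. intros b _. unfold pair_term.
    rewrite <- !Ropp_mult_distr_l, !cos_neg. reflexivity.
  - apply is_lim_seq_opp in H2. simpl in H2.
    apply is_lim_seq_unique in H2, H4. apply Rbar_finite_eq. rewrite <- H2, <- H4.
    apply Lim_seq_ext. intros N.
    match goal with |- _ = - ?x => replace (- x) with (-1 * x) by ring end.
    rewrite <- rsum_scal. apply rsum_ext. intros b _. unfold pair_term.
    rewrite <- !Ropp_mult_distr_l, !sin_neg. ring.
Qed.

Lemma pair_sum_bound_growth B t :
  Rabs (pair_sum_re B t) <= growth t /\ Rabs (pair_sum_im B t) <= growth t.
Proof.
  assert (Hg : growth t = (1 + Rabs t / (1 / 2)) * exp (- (1 / 2 * ln_u 0))).
  { unfold growth, ln_u. simpl. rewrite ln_odd_0, Rmult_0_r, Ropp_0, exp_0. ring. }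
  rewrite Hg. split.
  - apply (pair_sum_bound (Rabs t) (fun x => cos (t * x)) ln_u ln_v (1 / 2) 0 B);
      [apply unit_lipschitz_cos|apply interlaced_ln|lra].
  - apply (pair_sum_bound (Rabs t) (fun x => - sin (t * x)) ln_u ln_v (1 / 2) 0 B);
      [apply unit_lipschitz_opp_sin|apply interlaced_ln|lra].
Qed.

Lemma continuous_growth t : continuous growth t.
Proof.
  unfold growth. apply (continuous_plus (fun _ => 1)); [apply continuous_const|].
  apply (continuous_mult Rabs (fun _ => / (1 / 2))); [apply continuous_Rabs|apply continuous_const].
Qed.

Lemma growth_ge_1 t : 1 <= growth t.
Proof.
  unfold growth.
  assert (0 <= Rabs t / (1 / 2)) by (apply Rdiv_le_0_compat; [apply Rabs_pos|lra]). lra.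
Qed.

(** The weight [w] is bounded near each point, so the convergence is locally uniform. *)
Lemma continuous_weighted_limit (f w : R -> R) (fN : nat -> R -> R) (e : nat -> R) :
  (forall N t, continuous (fN N) t) -> (forall t, continuous w t) ->
  (forall N, 0 <= e N) -> is_lim_seq e 0 ->
  (forall N t, Rabs (f t - fN N t) <= w t * e N) ->
  forall t, continuous f t.
Proof.
  intros HN Hw He0 He H t0. apply filterlim_locally. intros eps.
  assert (Heps := cond_pos eps).
  assert (Hw0 : 0 < Rabs (w t0) + 1) by (generalize (Rabs_pos (w t0)); lra).
  assert (Hp : 0 < eps / 3 / (Rabs (w t0) + 1)) by (apply Rdiv_lt_0_compat; lra).
  apply is_lim_seq_spec in He. destruct (He (mkposreal _ Hp)) as [N HeN].
  specialize (HeN N (le_n N)). simpl in HeN. rewrite Rminus_0_r, Rabs_pos_eq in HeN by apply He0.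
  assert (Hp3 : 0 < eps / 3) by lra.
  assert (L1 := proj1 (filterlim_locally _ _) (HN N t0) (mkposreal _ Hp3)).
  assert (L2 := proj1 (filterlim_locally _ _) (Hw t0) (mkposreal 1 Rlt_0_1)).
  generalize (filter_and _ _ L1 L2). apply filter_imp. intros t [B1 B2].
  change (Rabs (fN N t - fN N t0) < eps / 3) in B1. change (Rabs (w t - w t0) < 1) in B2.
  change (Rabs (f t - f t0) < eps).
  assert (Hsmall : forall x, w x <= Rabs (w t0) + 1 -> Rabs (f x - fN N x) <= eps / 3).
  { intros x Hx. eapply Rle_trans; [apply H|].
    apply Rle_trans with ((Rabs (w t0) + 1) * e N); [apply Rmult_le_compat_r; auto|].
    apply Rmult_lt_compat_l with (r := Rabs (w t0) + 1) in HeN; [|exact Hw0].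
    replace ((Rabs (w t0) + 1) * (eps / 3 / (Rabs (w t0) + 1))) with (eps / 3) in HeN by (field; lra).
    lra. }
  assert (Ha := Rle_abs (w t0)).
  apply Rabs_def2 in B2.
  assert (C1 := Hsmall t ltac:(lra)). assert (C0 := Hsmall t0 ltac:(lra)).
  apply Rabs_def2 in B1. apply Rabs_le_between in C1. apply Rabs_le_between in C0.
  apply Rabs_def1; lra.
Qed.

Lemma continuous_pair_sum B t :
  continuous (pair_sum_re B) t /\ continuous (pair_sum_im B) t.
Proof.
  split.
  - apply (continuous_rsum (fun b t => pair_term (fun x => cos (t * x)) (1 / 2) (ln_u b) (ln_v b))).
    intros b _. unfold pair_term. apply @ex_derive_continuous. now auto_derive.
  - apply (continuous_rsum (fun b t => pair_term (fun x => - sin (t * x)) (1 / 2) (ln_u b) (ln_v b))).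
    intros b _. unfold pair_term. apply @ex_derive_continuous. now auto_derive.
Qed.

Lemma continuous_L_chi4 (L : C -> C) t :
  is_L_chi4 L ->
  continuous (fun t => fst (L (1 / 2, t))) t /\ continuous (fun t => snd (L (1 / 2, t))) t.
Proof.
  intros HL. split.
  - apply (continuous_weighted_limit _ growth pair_sum_re error).
    + intros N x. apply continuous_pair_sum.
    + apply continuous_growth.
    + intros N. left. apply error_bounds.
    + apply error_lim.
    + intros N x. now apply L_chi4_pair_sum_error.
  - apply (continuous_weighted_limit _ growth pair_sum_im error).
    + intros N x. apply continuous_pair_sum.
    + apply continuous_growth.
    + intros N. left. apply error_bounds.
    + apply error_lim.
    + intros N x. now apply L_chi4_pair_sum_error.
Qed.

(** * The squared modulus and its approximation by double sums *)

Definition L_sqr (L : C -> C) (t : R) : R := fst (L (1 / 2, t)) ^ 2 + snd (L (1 / 2, t)) ^ 2.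
Definition pair_sum_sqr (B : nat) (t : R) : R := pair_sum_re B t ^ 2 + pair_sum_im B t ^ 2.

Lemma continuous_sum_sqr (f g : R -> R) t :
  continuous f t -> continuous g t -> continuous (fun t => f t ^ 2 + g t ^ 2) t.
Proof.
  intros Hf Hg.
  apply (continuous_ext (fun t => f t * f t + g t * g t)); [intros x; simpl; ring|].
  apply (continuous_plus (fun t => f t * f t)).
  - now apply (continuous_mult f f).
  - now apply (continuous_mult g g).
Qed.

Lemma sqr_diff_bound a b w e :
  Rabs (a - b) <= w * e -> Rabs b <= w -> 0 <= e <= 1 -> Rabs (a ^ 2 - b ^ 2) <= 3 * (w * w) * e.
Proof.
  intros H Hb He. assert (Hw : 0 <= w) by (generalize (Rabs_pos b); lra).
  replace (a ^ 2 - b ^ 2) with ((a - b) * ((a - b) + 2 * b)) by ring.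
  rewrite Rabs_mult.
  assert (H2 : Rabs ((a - b) + 2 * b) <= 3 * w).
  { eapply Rle_trans; [apply Rabs_triang|]. rewrite Rabs_mult, (Rabs_pos_eq 2) by lra. nra. }
  apply Rle_trans with ((w * e) * (3 * w)); [|right; ring].
  apply Rmult_le_compat; try assumption; apply Rabs_pos.
Qed.

Lemma L_sqr_error (L : C -> C) B t :
  is_L_chi4 L ->
  Rabs (L_sqr L t - pair_sum_sqr B t) <= 6 * (growth t * growth t) * error B.
Proof.
  intros HL. destruct (L_chi4_pair_sum_error L B t HL) as [H1 H2].
  destruct (pair_sum_bound_growth B t) as [H3 H4]. assert (He := error_bounds B).
  assert (Q1 := sqr_diff_bound _ _ _ _ H1 H3 ltac:(lra)).
  assert (Q2 := sqr_diff_bound _ _ _ _ H2 H4 ltac:(lra)).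
  unfold L_sqr, pair_sum_sqr.
  replace (fst (L (1 / 2, t)) ^ 2 + snd (L (1 / 2, t)) ^ 2 - (pair_sum_re B t ^ 2 + pair_sum_im B t ^ 2))
    with ((fst (L (1 / 2, t)) ^ 2 - pair_sum_re B t ^ 2)
          + (snd (L (1 / 2, t)) ^ 2 - pair_sum_im B t ^ 2)) by ring.
  eapply Rle_trans; [apply Rabs_triang|]. lra.
Qed.

(** 1 + 2 t <= 4 (1 + t / 2) <= 4 exp (t / 2) bounds the square by 16 exp t, while pi > 2 gives exp
    (2 t) <= 2 cosh (pi t); hence 32. *)
Lemma growth_sqr_div_cosh t :
  0 <= t -> growth t * growth t * / cosh (PI * t) <= 32 * exp (- t).
Proof.
  intros Ht. assert (Hpi := PI2_1).
  assert (Hg : growth t * growth t <= 16 * exp t).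
  { unfold growth. rewrite Rabs_pos_eq by exact Ht.
    assert (H := exp_ineq1_le (t / 2)).
    replace t with (t / 2 + t / 2) at 3 by field. rewrite exp_plus.
    assert ((1 + t / 2) * (1 + t / 2) <= exp (t / 2) * exp (t / 2))
      by (apply Rmult_le_compat; lra).
    nra. }
  assert (Hc : exp t * exp t <= 2 * cosh (PI * t)).
  { rewrite <- exp_plus. unfold cosh.
    assert (exp (t + t) <= exp (PI * t)) by (apply exp_le; nra).
    generalize (exp_pos (- (PI * t))). lra. }
  assert (Hp := cosh_pos (PI * t)). assert (He := exp_pos t). assert (Hne := exp_pos (- t)).
  assert (E : exp t * exp (- t) = 1) by (rewrite <- exp_plus, Rplus_opp_r; apply exp_0).
  apply Rmult_le_reg_r with (cosh (PI * t)); [exact Hp|].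
  rewrite Rmult_assoc, Rinv_l, Rmult_1_r by lra.
  apply Rle_trans with (16 * exp t); [exact Hg|].
  apply Rmult_le_compat_l with (r := exp (- t)) in Hc; [|lra].
  replace (exp (- t) * (exp t * exp t)) with (exp t * exp (- t) * exp t) in Hc by ring.
  rewrite E in Hc. lra.
Qed.

(** This is chi4 (j) / sqrt j for the odd number j = 2 a + 1. *)
Definition coef (a : nat) : R := (-1) ^ a * exp (- (1 / 2 * ln_odd a)).

Lemma pair_sum_odd phi B :
  rsum (fun b => pair_term phi (1 / 2) (ln_u b) (ln_v b)) B
  = rsum (fun a => coef a * phi (ln_odd a)) (2 * B).
Proof.
  rewrite rsum_even. apply rsum_ext. intros b _. unfold pair_term, coef, ln_u, ln_v.
  rewrite (pow_m1_even (2 * b)), (pow_m1_odd (2 * b + 1)); [ring|exists b; lia|exists b; lia].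
Qed.

Lemma pair_sum_sqr_double_sum B t :
  pair_sum_sqr B t =
  rsum (fun a => rsum (fun c => coef a * coef c * cos ((ln_odd a - ln_odd c) * t)) (2 * B)) (2 * B).
Proof.
  unfold pair_sum_sqr, pair_sum_re, pair_sum_im.
  rewrite (pair_sum_odd (fun x => cos (t * x))), (pair_sum_odd (fun x => - sin (t * x))).
  simpl pow. rewrite !Rmult_1_r, !rsum_mult, <- rsum_plus. apply rsum_ext. intros a _.
  rewrite <- rsum_plus. apply rsum_ext. intros c _.
  replace ((ln_odd a - ln_odd c) * t) with (t * ln_odd a - t * ln_odd c) by ring.
  rewrite cos_minus. ring.
Qed.

Definition sech_half (x : R) : R := / (2 * cosh (x / 2)).

Lemma half_int_pair_sum_sqr lam B :
  half_int (fun t => pair_sum_sqr B t * (cos (lam * t) / cosh (PI * t)))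
    (rsum (fun a => rsum (fun c => coef a * coef c * sech_half (ln_odd c - ln_odd a + lam)) (2 * B)) (2 * B)).
Proof.
  set (S1 := rsum (fun a => rsum (fun c => coef a * coef c *
               sech_half (ln_odd c - ln_odd a + lam)) (2 * B)) (2 * B)).
  (* Turning the product of cosines into a sum produces the shifts + lam and - lam; exchanging a
     with c and using that sech is even shows that both give the same double sum. *)
  assert (ES : S1 = rsum (fun a => rsum (fun c => (coef a * coef c / 2) *
     (sech_half (ln_odd a - ln_odd c + lam) + sech_half (ln_odd a - ln_odd c - lam))) (2 * B)) (2 * B)).
  { assert (E1 : S1 = rsum (fun a => rsum (fun c => coef a * coef c *
               sech_half (ln_odd a - ln_odd c + lam)) (2 * B)) (2 * B)).
    { unfold S1. rewrite rsum_swap. apply rsum_ext. intros a _. apply rsum_ext. intros c _. ring. }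
    assert (E2 : S1 = rsum (fun a => rsum (fun c => coef a * coef c *
               sech_half (ln_odd a - ln_odd c - lam)) (2 * B)) (2 * B)).
    { unfold S1. apply rsum_ext. intros a _. apply rsum_ext. intros c _.
      f_equal. unfold sech_half.
      replace ((ln_odd a - ln_odd c - lam) / 2) with (- ((ln_odd c - ln_odd a + lam) / 2)) by field.
      now rewrite cosh_opp. }
    replace S1 with (/ 2 * (S1 + S1)) by field. rewrite E1 at 1. rewrite E2.
    rewrite <- rsum_plus, <- rsum_scal. apply rsum_ext. intros a _.
    rewrite <- rsum_plus, <- rsum_scal. apply rsum_ext. intros c _. field. }
  rewrite ES.
  apply (half_int_ext (fun t => rsum (fun a => rsum (fun c => (coef a * coef c / 2) *
     (cos ((ln_odd a - ln_odd c + lam) * t) / cosh (PI * t) +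
      cos ((ln_odd a - ln_odd c - lam) * t) / cosh (PI * t))) (2 * B)) (2 * B))).
  - intros t. rewrite pair_sum_sqr_double_sum, (Rmult_comm (rsum _ _)), <- rsum_scal.
    apply rsum_ext. intros a _. rewrite <- rsum_scal. apply rsum_ext. intros c _.
    replace ((ln_odd a - ln_odd c + lam) * t) with ((ln_odd a - ln_odd c) * t + lam * t) by ring.
    replace ((ln_odd a - ln_odd c - lam) * t) with ((ln_odd a - ln_odd c) * t - lam * t) by ring.
    rewrite cos_plus, cos_minus. field. generalize (cosh_pos (PI * t)). lra.
  - apply (half_int_rsum (fun a t => rsum (fun c => (coef a * coef c / 2) *
     (cos ((ln_odd a - ln_odd c + lam) * t) / cosh (PI * t) +
      cos ((ln_odd a - ln_odd c - lam) * t) / cosh (PI * t))) (2 * B))). intros a _.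
    apply (half_int_rsum (fun c t => (coef a * coef c / 2) *
     (cos ((ln_odd a - ln_odd c + lam) * t) / cosh (PI * t) +
      cos ((ln_odd a - ln_odd c - lam) * t) / cosh (PI * t)))). intros c _.
    apply half_int_scal, half_int_plus; apply half_int_cos_div_cosh.
Qed.

Lemma exp_half_ln x : 0 < x -> exp (ln x / 2) = sqrt x.
Proof. intros Hx. rewrite <- Rpower_sqrt by exact Hx. unfold Rpower. f_equal. field. Qed.

(** With j = 2 a + 1 and k = 2 c + 1, twice the cosh of half of ln (k m / (j n)) is (n j + m k) /
    sqrt (j k n m); the square roots of j and k cancel against the coefficients. *)
Lemma coef_sech_half n m a c :
  (1 <= n)%nat -> (1 <= m)%nat ->
  sqrt (INR n * INR m) * (coef a * coef c * sech_half (ln_odd c - ln_odd a + ln (INR m / INR n)))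
  = INR n * INR m * ((-1) ^ a * (-1) ^ c
       * / (INR n * INR (2 * a + 1) + INR m * INR (2 * c + 1))).
Proof.
  intros Hn Hm. apply INR_pos in Hn. apply INR_pos in Hm.
  set (j := INR (2 * a + 1)). set (k := INR (2 * c + 1)).
  assert (Hj : 0 < j) by (apply INR_pos; lia). assert (Hk : 0 < k) by (apply INR_pos; lia).
  unfold coef, sech_half, ln_odd. fold j k.
  rewrite ln_div, sqrt_mult by lra.
  rewrite <- (exp_half_ln (INR n)), <- (exp_half_ln (INR m)) by assumption.
  assert (Hsq : forall x, 0 < x -> exp (ln x / 2) * exp (ln x / 2) = x).
  { intros x Hx. rewrite <- exp_plus. replace (ln x / 2 + ln x / 2) with (ln x) by field.
    now apply exp_ln. }
  assert (Ej := Hsq j Hj). assert (Ek := Hsq k Hk).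
  assert (En := Hsq _ Hn). assert (Em := Hsq _ Hm).
  unfold cosh.
  replace ((ln k - ln j + (ln (INR m) - ln (INR n))) / 2)
    with (ln k / 2 + - (ln j / 2) + ln (INR m) / 2 + - (ln (INR n) / 2)) by field.
  rewrite !exp_Ropp, !exp_plus, !exp_Ropp.
  replace (1 / 2 * ln j) with (ln j / 2) by field. replace (1 / 2 * ln k) with (ln k / 2) by field.
  assert (Hx := exp_pos (ln j / 2)). assert (Hy := exp_pos (ln k / 2)).
  assert (Hz := exp_pos (ln (INR n) / 2)). assert (Hw := exp_pos (ln (INR m) / 2)).
  set (x := exp (ln j / 2)) in *. set (y := exp (ln k / 2)) in *.
  set (z := exp (ln (INR n) / 2)) in *. set (w := exp (ln (INR m) / 2)) in *.
  clearbody x y z w. rewrite <- Ej, <- Ek, <- En, <- Em.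
  field. repeat split; nra.
Qed.

Lemma half_int_exp b : 0 < b -> half_int (fun x => exp (- (b * x))) (/ b).
Proof.
  intros Hb. replace (/ b) with (b / (0 * 0 + b * b)) by (field; lra).
  apply (half_int_ext (fun x => exp (- (b * x)) * cos (0 * x))).
  - intros x. rewrite Rmult_0_l, cos_0. ring.
  - now apply half_int_exp_cos.
Qed.

Definition double_sum (n m B : nat) : R :=
  rsum (fun a => rsum (fun c => (-1) ^ a * (-1) ^ c
     * / (INR n * INR (2 * a + 1) + INR m * INR (2 * c + 1))) (2 * B)) (2 * B).

Lemma truncation_error p q c d :
  0 <= p <= 1 -> 0 <= q <= 1 -> 1 <= c -> 1 <= d ->
  Rabs (/ 4 * / (c * d) - (1 - p) / (2 * c) * ((1 - q) / (2 * d))) <= p + q.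
Proof.
  intros Hp Hq Hc Hd.
  replace (/ 4 * / (c * d) - (1 - p) / (2 * c) * ((1 - q) / (2 * d)))
    with ((p + q - p * q) * / (4 * (c * d))) by (field; lra).
  assert (Hi : 0 < / (4 * (c * d)) <= 1).
  { split; [apply Rinv_0_lt_compat; nra|]. rewrite <- Rinv_1. apply Rinv_le_contravar; nra. }
  assert (0 <= p * q) by nra. assert (0 <= p + q - p * q) by nra.
  rewrite Rabs_pos_eq by nra. nra.
Qed.

(** 1 / (n j + m k) is the integral of exp (- (n j + m k) x), so the double sum integrates a product
    of two truncated geometric series, each tending to half a secant; hence the factor 1 / 4. *)
Lemma double_sum_lim n m V :
  (1 <= n)%nat -> (1 <= m)%nat ->
  half_int (fun x => / (cosh (INR n * x) * cosh (INR m * x))) V ->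
  is_lim_seq (double_sum n m) (/ 4 * V).
Proof.
  intros Hn Hm HV.
  assert (HnR : 1 <= INR n) by (change 1 with (INR 1); apply le_INR; lia).
  assert (HmR : 1 <= INR m) by (change 1 with (INR 1); apply le_INR; lia).
  apply is_lim_seq_incr_1.
  set (term := fun (r : nat) B x =>
         rsum (fun k => (-1) ^ k * exp (- ((2 * INR k + 1) * (INR r * x)))) (2 * B)).
  apply (half_int_limit_values (fun x => / 4 * / (cosh (INR n * x) * cosh (INR m * x)))
    (fun B x => term n (S B) x * term m (S B) x) _
    (fun B => 2 / (4 * INR (S B)))).
  - now apply half_int_scal.
  - intros B. unfold double_sum.
    apply (half_int_ext (fun x => rsum (fun a => rsum (fun c => (-1) ^ a * (-1) ^ c
       * exp (- ((INR n * INR (2 * a + 1) + INR m * INR (2 * c + 1)) * x))) (2 * S B)) (2 * S B))).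
    + intros x. unfold term. rewrite rsum_mult. apply rsum_ext. intros a _.
      apply rsum_ext. intros c _.
      rewrite !plus_INR, !mult_INR. change (INR 1) with 1. change (INR 2) with 2.
      replace (- ((INR n * (2 * INR a + 1) + INR m * (2 * INR c + 1)) * x))
        with (- ((2 * INR a + 1) * (INR n * x)) + - ((2 * INR c + 1) * (INR m * x))) by ring.
      rewrite exp_plus. ring.
    + apply (half_int_rsum (fun a x => rsum (fun c => (-1) ^ a * (-1) ^ c
       * exp (- ((INR n * INR (2 * a + 1) + INR m * INR (2 * c + 1)) * x))) (2 * S B))).
      intros a _.
      apply (half_int_rsum (fun c x => (-1) ^ a * (-1) ^ c
       * exp (- ((INR n * INR (2 * a + 1) + INR m * INR (2 * c + 1)) * x)))).
      intros c _. apply half_int_scal, half_int_exp.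
      assert (0 < INR (2 * a + 1)) by (apply INR_pos; lia).
      assert (0 < INR (2 * c + 1)) by (apply INR_pos; lia). nra.
  - intros B b Hb. assert (HB : 0 < INR (S B)) by (apply INR_pos; lia).
    apply RInt_diff_exp_bound; try lra.
    + intros x. apply @ex_derive_continuous. auto_derive.
      generalize (cosh_pos (INR n * x)) (cosh_pos (INR m * x)). intros. nra.
    + assert (Ht : forall r x, continuous (term r (S B)) x).
      { intros r x. apply (continuous_rsum (fun k x => (-1) ^ k * exp (- ((2 * INR k + 1) * (INR r * x))))).
        intros k _. apply @ex_derive_continuous. now auto_derive. }
      intros x. now apply (continuous_mult (term n (S B)) (term m (S B))).
    + intros x Hx. unfold term. rewrite !rsum_alternating_exp.
      (* An even number of terms makes each truncation (1 - p) / (2 cosh) with 0 <= p <= 1. As n, m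
         >= 1, both defects p are at most exp (- 4 (B + 1) x). *)
      rewrite (pow_m1_even (2 * S B)), !Rmult_1_l by (exists (S B); reflexivity).
      rewrite mult_INR. change (INR 2) with 2.
      assert (Hr : forall r, 1 <= r -> 0 <= exp (- (2 * (2 * INR (S B)) * (r * x)))
                       <= exp (- (4 * INR (S B) * x))).
      { intros r Hr. split; [left; apply exp_pos|]. apply exp_le.
        assert (0 <= INR (S B) * x) by nra. nra. }
      assert (H1 : exp (- (4 * INR (S B) * x)) <= 1)
        by (rewrite <- exp_0; apply exp_le; nra).
      assert (Rn := Hr _ HnR). assert (Rm := Hr _ HmR).
      eapply Rle_trans; [apply truncation_error; try apply cosh_ge_1; lra|]. lra.
  - apply is_lim_seq_div_INR. lra.
Qed.

Lemma half_int_L_chi4 (L : C -> C) n m V :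
  is_L_chi4 L -> (1 <= n)%nat -> (1 <= m)%nat ->
  half_int (fun x => / (cosh (INR n * x) * cosh (INR m * x))) V ->
  half_int (fun t => L_sqr L t * (cos (ln (INR m / INR n) * t) / cosh (PI * t)))
    (/ sqrt (INR n * INR m) * (INR n * INR m * (/ 4 * V))).
Proof.
  intros HL Hn Hm HV. set (lam := ln (INR m / INR n)).
  assert (Hs : 0 < sqrt (INR n * INR m))
    by (apply sqrt_lt_R0, Rmult_lt_0_compat; apply INR_pos; assumption).
  assert (Hc : forall lam t, continuous (fun t => cos (lam * t) / cosh (PI * t)) t).
  { intros l t. apply @ex_derive_continuous. auto_derive. generalize (cosh_pos (PI * t)). lra. }
  (* 192 = 6 * 32: 6 from the error in the squared modulus, 32 from the decay of [growth] squared
     over cosh. *)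
  apply (half_int_limit _
    (fun B t => pair_sum_sqr B t * (cos (lam * t) / cosh (PI * t)))
    (fun B => / sqrt (INR n * INR m) * (INR n * INR m * double_sum n m B))
    (fun B => 192 * error B)).
  - intros t. apply (continuous_mult (L_sqr L)); [|apply Hc].
    apply (continuous_sum_sqr (fun t => fst (L (1 / 2, t))) (fun t => snd (L (1 / 2, t))));
      now apply continuous_L_chi4.
  - intros B.
    replace (/ sqrt (INR n * INR m) * (INR n * INR m * double_sum n m B))
      with (rsum (fun a => rsum (fun c => coef a * coef c *
              sech_half (ln_odd c - ln_odd a + lam)) (2 * B)) (2 * B)).
    + apply half_int_pair_sum_sqr.
    + apply Rmult_eq_reg_l with (sqrt (INR n * INR m)); [|lra].
      rewrite <- Rmult_assoc, Rinv_r, Rmult_1_l by lra.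
      unfold double_sum. rewrite <- !rsum_scal. apply rsum_ext. intros a _.
      rewrite <- !rsum_scal. apply rsum_ext. intros c _. now apply coef_sech_half.
  - intros B b Hb. replace (192 * error B) with (192 * error B / 1) by field.
    assert (He := error_bounds B).
    apply RInt_diff_exp_bound; try lra.
    + intros t. apply (continuous_mult (L_sqr L)); [|apply Hc].
      apply (continuous_sum_sqr (fun t => fst (L (1 / 2, t))) (fun t => snd (L (1 / 2, t))));
        now apply continuous_L_chi4.
    + intros t. apply (continuous_mult (pair_sum_sqr B)); [|apply Hc].
      apply (continuous_sum_sqr (pair_sum_re B) (pair_sum_im B)); apply continuous_pair_sum.
    + intros t Ht. rewrite Rmult_1_l, <- Rmult_minus_distr_r.
      assert (H1 := L_sqr_error L B t HL). assert (H2 := growth_sqr_div_cosh t Ht).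
      assert (Hci : 0 < / cosh (PI * t)) by apply Rinv_0_lt_compat, cosh_pos.
      unfold Rdiv. rewrite !Rabs_mult, (Rabs_pos_eq (/ _)) by lra.
      assert (Hcos : Rabs (cos (lam * t)) <= 1) by (apply Rabs_le, COS_bound).
      apply Rle_trans with (6 * (growth t * growth t) * error B * (1 * / cosh (PI * t))).
      * apply Rmult_le_compat; [apply Rabs_pos| |exact H1|apply Rmult_le_compat_r; lra].
        apply Rmult_le_pos; [apply Rabs_pos|lra].
      * replace (6 * (growth t * growth t) * error B * (1 * / cosh (PI * t)))
          with (6 * error B * (growth t * growth t * / cosh (PI * t))) by ring.
        replace (192 * error B * exp (- t)) with (6 * error B * (32 * exp (- t))) by ring.
        apply Rmult_le_compat_l; lra.
  - replace (Finite 0) with (Rbar_mult 192 0) by (simpl; f_equal; ring).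
    apply (is_lim_seq_scal_l _ 192 0), error_lim.
  - apply (is_lim_seq_scal_l _ _ (INR n * INR m * (/ 4 * V))).
    apply (is_lim_seq_scal_l _ _ (/ 4 * V)). now apply double_sum_lim.
Qed.

(** * From the half-line to the whole line *)

Lemma RInt_reflect (f : R -> R) a b :
  (forall x, continuous f x) -> RInt (fun y => f (- y)) a b = - RInt f (- a) (- b).
Proof.
  intros Hf.
  assert (H : is_RInt f (- a) (- b) (RInt f (- a) (- b)))
    by (apply (RInt_correct f), continuous_ex_RInt, Hf).
  apply (is_RInt_comp_opp f) in H. apply (is_RInt_opp (fun y => opp (f (- y)))) in H.
  apply is_RInt_unique. eapply is_RInt_ext; [|exact H].
  intros x _. apply opp_opp.
Qed.

Lemma RInt_tail_bound (f : R -> R) K X x y :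
  (forall t, continuous f t) -> (forall t, 0 <= t -> Rabs (f t) <= K * exp (- t)) ->
  0 <= K -> 0 <= X -> X <= x -> X <= y -> Rabs (RInt f x y) <= K * exp (- X).
Proof.
  intros Hf Hb HK HX.
  assert (Hmain : forall x y, X <= x -> x <= y -> Rabs (RInt f x y) <= K * exp (- X)).
  { clear x y. intros x y Hx Hxy.
    eapply Rle_trans; [apply abs_RInt_le; [exact Hxy|now apply continuous_ex_RInt]|].
    apply Rle_trans with (RInt (fun t => K * exp (- t)) x y).
    - apply RInt_le; [exact Hxy| | |].
      + apply continuous_ex_RInt. intros t. apply (continuous_comp f Rabs); [apply Hf|apply continuous_Rabs].
      + apply continuous_ex_RInt. intros t. apply @ex_derive_continuous. now auto_derive.
      + intros t Ht. apply Hb. lra.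
    - rewrite (is_RInt_unique _ x y (minus (- K * exp (- y)) (- K * exp (- x)))).
      + unfold minus, plus, opp; simpl.
        assert (exp (- x) <= exp (- X)) by (apply exp_le; lra).
        generalize (exp_pos (- y)). intros. nra.
      + apply (@is_RInt_derive R_CompleteNormedModule (fun t => - K * exp (- t))).
        * intros t _. auto_derive; [trivial|]. ring.
        * intros t _. apply @ex_derive_continuous. now auto_derive. }
  intros Hx Hy. destruct (Rle_lt_dec x y) as [Hxy|Hxy]; [now apply Hmain|].
  replace (RInt f x y) with (- RInt f y x) by (apply (opp_RInt_swap f), continuous_ex_RInt, Hf).
  rewrite Rabs_Ropp. apply Hmain; lra.
Qed.

(** The two ends tend to infinity independently, so oddness alone does not annihilate the integral
    of g: cancelling over [a, - a] leaves the integral from - a to b, which the exponential bound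
    makes small. *)
Lemma is_integral_over_R_even_odd (f g : R -> R) J K :
  half_int f J -> (forall t, f (- t) = f t) ->
  (forall t, continuous g t) -> (forall t, g (- t) = - g t) ->
  0 <= K -> (forall t, 0 <= t -> Rabs (g t) <= K * exp (- t)) ->
  is_integral_over_R (fun t => (f t, g t)) (RtoC (2 * J)).
Proof.
  intros [Hfc HJ] Hfe Hgc Hgo HK HgK P [eps HP].
  assert (Heps := cond_pos eps).
  destruct (HJ (eps / 2)) as [X1 [HX1 B1]]; [lra|].
  (* Chosen so that K < K + 1 = eps X2 <= eps exp X2. *)
  set (X2 := (K + 1) / eps).
  assert (HX2 : 0 < X2) by (apply Rdiv_lt_0_compat; lra).
  assert (HgX : K * exp (- X2) < eps).
  { assert (He := exp_ineq1_le X2). rewrite exp_Ropp.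
    apply Rmult_lt_reg_r with (exp X2); [apply exp_pos|].
    rewrite Rmult_assoc, Rinv_l, Rmult_1_r by (generalize (exp_pos X2); lra).
    apply Rlt_le_trans with (eps * X2); [unfold X2; field_simplify; lra|].
    apply Rmult_le_compat_l; lra. }
  set (X := Rmax X1 X2).
  assert (HXX1 : X1 <= X) by apply Rmax_l. assert (HXX2 : X2 <= X) by apply Rmax_r.
  apply (Filter_prod _ _ _ (fun a => a < - X) (fun b => X < b)).
  - exists (- X). auto.
  - exists X. auto.
  - intros a b Ha Hb. exists (RInt f a b, RInt g a b). simpl. split.
    + apply (is_RInt_fct_extend_pair (fun t => (f t, g t)));
        [apply (RInt_correct f)|apply (RInt_correct g)]; now apply continuous_ex_RInt.
    + apply HP.
      assert (Ef : RInt f a b = RInt f 0 (- a) + RInt f 0 b).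
      { rewrite <- (RInt_Chasles f a 0 b) by now apply continuous_ex_RInt.
        unfold plus; simpl. f_equal.
        rewrite (RInt_ext f (fun y => f (- y)) a 0) by (intros; now rewrite Hfe).
        rewrite RInt_reflect, Ropp_0 by exact Hfc.
        apply (opp_RInt_swap f), continuous_ex_RInt, Hfc. }
      assert (Eg : RInt g a b = RInt g (- a) b).
      { rewrite <- (RInt_Chasles g a (- a) b) by now apply continuous_ex_RInt.
        unfold plus; simpl. enough (RInt g a (- a) = 0) by lra.
        enough (RInt g a (- a) = - RInt g a (- a)) by lra.
        rewrite (RInt_ext g (fun y => - g (- y)) a (- a)) at 1
          by (intros; now rewrite Hgo, Ropp_involutive).
        rewrite (RInt_opp (fun y => g (- y)))
          by (apply continuous_ex_RInt; intros x;
              apply (continuous_comp Ropp g); [apply @ex_derive_continuous; now auto_derive|apply Hgc]).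
        unfold opp; simpl. rewrite RInt_reflect, Ropp_involutive by exact Hgc.
        rewrite Ropp_involutive. symmetry. apply (opp_RInt_swap g), continuous_ex_RInt, Hgc. }
      assert (C1 := B1 (- a) ltac:(lra)). assert (C2 := B1 b ltac:(lra)).
      assert (C3 := RInt_tail_bound g K X2 (- a) b Hgc HgK HK ltac:(lra) ltac:(lra) ltac:(lra)).
      split; simpl.
      * change (Rabs (RInt f a b - 2 * J) < eps). rewrite Ef.
        replace (RInt f 0 (- a) + RInt f 0 b - 2 * J)
          with ((RInt f 0 (- a) - J) + (RInt f 0 b - J)) by ring.
        eapply Rle_lt_trans; [apply Rabs_triang|]. lra.
      * change (Rabs (RInt g a b - 0) < eps). rewrite Eg, Rminus_0_r. lra.
Qed.

Lemma integrand_components (L : C -> C) alpha t :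
  integrand L alpha t =
  (L_sqr L t * (cos (ln alpha * t) / cosh (PI * t)), L_sqr L t * (sin (ln alpha * t) / cosh (PI * t))).
Proof.
  assert (Hc := cosh_pos (PI * t)).
  unfold integrand. rewrite Cmod2_alt. fold (L_sqr L t).
  unfold Re, Im. change (fst (L (1 / 2, t)) ^ 2 + snd (L (1 / 2, t)) ^ 2) with (L_sqr L t).
  unfold Cpow_pos, Cexp, Cdiv, Cinv, Cmult, RtoC, Re, Im; simpl.
  replace (0 * ln alpha - t * 0) with 0 by ring. rewrite exp_0.
  replace (0 * 0 + t * ln alpha) with (ln alpha * t) by ring.
  f_equal; field; lra.
Qed.

Lemma mean_value_eq (L : C -> C) n m V :
  is_L_chi4 L -> (1 <= n)%nat -> (1 <= m)%nat ->
  half_int (fun x => / (cosh (INR n * x) * cosh (INR m * x))) V ->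
  exists J : R, is_integral_over_R (integrand L (INR m / INR n)) (RtoC J) /\
    sqrt (INR n * INR m) * J = INR n * INR m / 2 * V.
Proof.
  intros HL Hn Hm HV.
  assert (Hs : 0 < sqrt (INR n * INR m))
    by (apply sqrt_lt_R0, Rmult_lt_0_compat; apply INR_pos; assumption).
  set (J := / sqrt (INR n * INR m) * (INR n * INR m * (/ 4 * V))).
  exists (2 * J). split; [|unfold J; field; lra].
  set (lam := ln (INR m / INR n)).
  assert (Heven : forall t, L_sqr L (- t) = L_sqr L t).
  { intros t. unfold L_sqr. destruct (L_chi4_conj L t HL) as [-> ->]. ring. }
  assert (Hint := is_integral_over_R_even_odd
    (fun t => L_sqr L t * (cos (lam * t) / cosh (PI * t)))
    (fun t => L_sqr L t * (sin (lam * t) / cosh (PI * t))) J 256).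
  unfold is_integral_over_R in *.
  eapply is_RInt_gen_ext; [|apply Hint].
  - apply filter_forall. intros ab x _. symmetry. apply integrand_components.
  - now apply half_int_L_chi4.
  - intros t. rewrite Heven.
    replace (lam * - t) with (- (lam * t)) by ring. replace (PI * - t) with (- (PI * t)) by ring.
    now rewrite cos_neg, cosh_opp.
  - intros t. apply (continuous_mult (L_sqr L)).
    + apply (continuous_sum_sqr (fun t => fst (L (1 / 2, t))) (fun t => snd (L (1 / 2, t))));
        now apply continuous_L_chi4.
    + apply @ex_derive_continuous. auto_derive. generalize (cosh_pos (PI * t)). lra.
  - intros t. rewrite Heven.
    replace (lam * - t) with (- (lam * t)) by ring. replace (PI * - t) with (- (PI * t)) by ring.
    rewrite sin_neg, cosh_opp. unfold Rdiv. ring.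
  - lra.
  - intros t Ht.
    (* Comparison with the empty partial sum bounds the squared modulus of L itself by 6 [growth]^2;
       the resulting constant 6 * 32 = 192 is below 256. *)
    assert (H1 := L_sqr_error L 0 t HL). assert (H2 := growth_sqr_div_cosh t Ht).
    assert (He := error_bounds 0).
    unfold pair_sum_sqr, pair_sum_re, pair_sum_im in H1. cbn [rsum] in H1.
    replace (L_sqr L t - (0 ^ 2 + 0 ^ 2)) with (L_sqr L t) in H1 by ring.
    assert (Hg := growth_ge_1 t).
    assert (Hci : 0 < / cosh (PI * t)) by apply Rinv_0_lt_compat, cosh_pos.
    unfold Rdiv. rewrite !Rabs_mult, (Rabs_pos_eq (/ _)) by lra.
    assert (Hsin : Rabs (sin (lam * t)) <= 1) by (apply Rabs_le, SIN_bound).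
    apply Rle_trans with (6 * (growth t * growth t) * 1 * (1 * / cosh (PI * t))).
    + apply Rmult_le_compat; [apply Rabs_pos| | |apply Rmult_le_compat_r; lra].
      * apply Rmult_le_pos; [apply Rabs_pos|lra].
      * eapply Rle_trans; [exact H1|]. apply Rmult_le_compat_l; nra.
    + replace (6 * (growth t * growth t) * 1 * (1 * / cosh (PI * t)))
        with (6 * (growth t * growth t * / cosh (PI * t))) by ring.
      generalize (exp_pos (- t)). lra.
Qed.

Theorem mainTheorem1 (L : C -> C) (HL : is_L_chi4 L)
    (n m : nat) (hn : (1 <= n)%nat) (hm : (1 <= m)%nat)
    (hgcd : Nat.gcd n m = 1%nat) :
  (Nat.Odd (n + m) ->
     exists I : C,
       is_integral_over_R (integrand L (INR m / INR n)) I /\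
       Cmult (RtoC (sqrt (INR n * INR m))) I =
       RtoC (PI / 4 * INR m * sum_odd n m + PI / 4 * INR n * sum_odd m n)) /\
  (Nat.Even (n + m) ->
     exists I : C,
       is_integral_over_R (integrand L (INR m / INR n)) I /\
       Cmult (RtoC (2 * sqrt (INR n * INR m))) I =
       RtoC (- PI * (INR m / INR n) * sum_even n m
             - PI * (INR n / INR m) * sum_even m n
             - (-1) ^ Nat.div (n + m) 2)).
Proof.
  assert (Hn := INR_pos n hn). assert (Hm := INR_pos m hm).
  split; intros Hpar.
  - destruct (mean_value_eq L n m _ HL hn hm (half_int_odd n m hn hm Hpar)) as [J [HJ E]].
    exists (RtoC J). split; [exact HJ|].
    rewrite <- RtoC_mult, E. f_equal. field. lra.
  - assert (Hno : exists p, n = (2 * p + 1)%nat).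
    { destruct (Nat.Even_or_Odd n) as [[p Hp]|[p Hp]]; [exfalso|now exists p].
      destruct Hpar as [r Hr].
      assert (D : Nat.divide 2 (Nat.gcd n m))
        by (apply Nat.gcd_greatest; [exists p|exists (r - p)%nat]; lia).
      rewrite hgcd in D. destruct D as [z Hz]. lia. }
    destruct Hno as [p Hp].
    assert (Hmo : exists q, m = (2 * q + 1)%nat).
    { destruct Hpar as [r Hr]. exists (r - p - 1)%nat. lia. }
    destruct Hmo as [q Hq]. subst n m.
    destruct (mean_value_eq L _ _ _ HL hn hm (half_int_even p q hgcd)) as [J [HJ E]].
    exists (RtoC J). split; [exact HJ|].
    (* (n + m) / 2 = p + q + 1, whence the minus sign in front of the last term. *)
    replace ((2 * p + 1 + (2 * q + 1)) / 2)%nat with (S (p + q))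
      by (replace (2 * p + 1 + (2 * q + 1))%nat with (S (p + q) * 2)%nat by lia;
          symmetry; apply Nat.div_mul; lia).
    rewrite <- RtoC_mult, Rmult_assoc, E. f_equal. simpl pow. field. lra.
Qed.
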